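(* Let $p\in\mathbb{C}[z_1,z_2]$ be pure stable, vanishing to order $M\ge1$ at $(0,0)$, with local Puiseux factorization data $q_j, L_j, M_j$ ($j=1,\dots,k$) as in the context. Let $A=(p+\bar p)/2$ and $B=(p-\bar p)/(2i)$. Then for all but finitely many $t\in\mathbb{R}$ we can factor, near $(0,0)$, $$A(z)+tB(z)=u(z;t)\prod_{j=1}^{k}\prod_{m=1}^{M_j}\left(z_2+q_j(z_1)+z_1^{2L_j}\psi_{j,m}(z_1;t)\right),$$ where, for each such $t$, $\psi_{j,m}(\cdot\,;t)\in\mathbb{R}\{z_1\}$, $u(\cdot\,;t)\in\mathbb{C}\{z_1,z_2\}$ and $u(0;t)\ne0$. Moreover this is best possible in the following sense: there do not exist a pair $(j,m)$, an integer $\tilde L_j$ with $2\tilde L_j>2L_j$, a polynomial $\tilde q_j$ (not depending on $t$) of degree less than $2\tilde L_j$ such that $\tilde q_j-q_j$ vanishes to order at least $2L_j$ at $0$, and functions $\tilde\psi_{j,m}(z_1;t)$ analytic in $z_1$ near $0$, such that for all but finitely many $t\in\mathbb{R}$ the factor corresponding to $(j,m)$ in the factorization above can be replaced with $$z_2+\tilde q_j(z_1)+z_1^{2\tilde L_j}\tilde\psi_{j,m}(z_1;t).$$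
   Context: $\mathbb{H}$ is the open upper half plane and $\bar p(z)=\overline{p(\bar z_1,\bar z_2)}$. A polynomial $p\in\mathbb{C}[z_1,z_2]$ is pure stable if it has no zeros in $\mathbb{H}^2$ and no nonconstant factor in common with $\bar p$. $\mathbb{C}\{\cdot\}$, $\mathbb{R}\{\cdot\}$ denote convergent power series rings at the origin. It is known that a pure stable $p$ vanishing at $(0,0)$ factors near $(0,0)$ as $$p(z)=u(z)\prod_{j=1}^{k}\prod_{m=1}^{M_j}\left(z_2+q_j(z_1)+z_1^{2L_j}\psi_j(\mu_j^mz_1^{1/M_j})\right),$$ where $u\in\mathbb{C}\{z_1,z_2\}$ is a unit, for each $j$ the inner product over $m$ is an irreducible Weierstrass polynomial in $z_2$ of degree $M_j$, $L_j$ is a positive integer, $\mu_j=e^{2\pi i/M_j}$, $q_j\in\mathbb{R}[z_1]$, $q_j(0)=0$, $q_j'(0)>0$, $\deg q_j<2L_j$, and $\psi_j\in\mathbb{C}\{t\}$ with $\operatorname{Im}\psi_j(0)>0$ (the product over $m$ is computed with any choice of $M_j$-th root of $z_1$ and does not depend on it). The data $q_j,L_j,M_j$ in the claim are those of this factorization. *)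

(* Defs.v *)
From HB Require Import structures.
From mathcomp Require Import all_boot all_order all_algebra polyXY.
From mathcomp Require Import complex.
From mathcomp Require Import boolp classical_sets functions cardinality reals.
From mathcomp Require Import topology normedtype sequences trigo.
Set Implicit Arguments.
Unset Strict Implicit.
Unset Printing Implicit Defensive.
Import Order.TTheory GRing.Theory Num.Theory.
Import numFieldNormedType.Exports.
Local Open Scope classical_set_scope.
Local Open Scope ring_scope.

(* C[z1, z2] is {poly {poly R[i]}}, where the outer indeterminate is z1 and the
   inner one is z2: p.[z1, z2] is the value of p, and p`_a`_b is the
   coefficient of z1^a z2^b.
   The topology of R[i] is carried by the alias R[i]^o. The order of R[i] is
   partial and 0 < r entails that r is real.                                  *)

Section Polynomials.
Variable R : realType.
Implicit Types p d f g : {poly {poly R[i]}}.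

Definition conj_poly p : {poly {poly R[i]}} := map_poly (map_poly (@conjc R)) p.

Lemma conj_polyE p (z1 z2 : R[i]) :
  (conj_poly p).[z1, z2] = ((p.[z1^*%C, z2^*%C])^*)%C.
Proof.
rewrite /conj_poly -{1}[z1]conjcK -{1}[z2]conjcK.
by rewrite -[(z1^*^*)%C%:P]map_polyC !horner_map.
Qed.

(* Stated with products: the library's %| on {poly {poly _}} is
   pseudo-divisibility, which ignores factors depending on z2 only. *)
Definition no_common_factor f g :=
  forall d f' g', f = d * f' -> g = d * g' -> exists c : R[i], d = c%:P%:P.

Definition pure_stable p :=
  (forall z1 z2 : R[i], 0 < complex.Im z1 -> 0 < complex.Im z2 ->
     p.[z1, z2] != 0) /\
  no_common_factor p (conj_poly p).

Definition vanishing_order p (M : nat) :=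
  (forall a b, (a + b < M)%N -> p`_a`_b = 0) /\
  (exists a b, (a + b = M)%N /\ p`_a`_b != 0).

Definition polyA p : {poly {poly R[i]}} := (2^-1)%:P *: (p + conj_poly p).
Definition polyB p : {poly {poly R[i]}} :=
  ((2 * 'i%C)^-1)%:P *: (p - conj_poly p).

End Polynomials.

Notation "'\near0' z1 z2 , P" :=
  (\forall z1 \near (0 : _[i]^o) & z2 \near (0 : _[i]^o), P)
  (at level 200, z1 name, z2 name, P at level 200).

Section Germs.
Variable R : realType.
Implicit Types (f g h : R[i] -> R[i] -> R[i]).

Definition analytic1 (f : R[i] -> R[i]) := exists a : nat -> R[i],
  \forall z \near (0 : R[i]^o),
    series (fun n => a n * z ^+ n) @ \oo --> (f z : R[i]^o).

Definition real_analytic1 (f : R[i] -> R[i]) := exists a : nat -> R,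
  \forall z \near (0 : R[i]^o),
    series (fun n => (a n)%:C%C * z ^+ n) @ \oo --> (f z : R[i]^o).

(* The geometric bound makes the double series absolutely convergent near the
   origin, so summing over squares is no restriction. *)
Definition analytic2 f := exists a : nat -> nat -> R[i],
  (exists r K : R[i], 0 < r /\ forall i j, `|a i j| * r ^+ (i + j) <= K) /\
  \near0 z1 z2,
    (fun N => \sum_(i < N) \sum_(j < N) a i j * z1 ^+ i * z2 ^+ j) @ \oo
      --> (f z1 z2 : R[i]^o).

Definition unit2 f := analytic2 f /\ f 0 0 != 0.

Definition irreducible2 f :=
  [/\ analytic2 f, ~ (\near0 z1 z2, f z1 z2 = 0), ~ unit2 f
    & forall g h, analytic2 g -> analytic2 h ->
        (\near0 z1 z2, f z1 z2 = g z1 z2 * h z1 z2) -> unit2 g \/ unit2 h].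

Definition weierstrass (d : nat) f := exists a : 'I_d -> R[i] -> R[i],
  (forall i, analytic1 (a i) /\ a i 0 = 0) /\
  \near0 z1 z2, f z1 z2 = z2 ^+ d + \sum_(i < d) a i z1 * z2 ^+ i.

End Germs.

Section Factorizations.
Variable R : realType.
Implicit Types (p : {poly {poly R[i]}}).

Definition complex_poly (q : {poly R}) : {poly R[i]} :=
  map_poly (real_complex R) q.

Definition factor (q : {poly R[i]}) (L : nat) (v z1 z2 : R[i]) : R[i] :=
  z2 + q.[z1] + z1 ^+ (2 * L) * v.

(* exp (2 pi i / n) *)
Definition root1 (n : nat) : R[i] :=
  (cos (2 * pi / n%:R) +i* sin (2 * pi / n%:R))%C.

(* w stands for the chosen M-th root of z1. *)
Definition branch_prod (q : {poly R}) (L M : nat) (psi : R[i] -> R[i])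
    (w z1 z2 : R[i]) : R[i] :=
  \prod_(1 <= m < M.+1)
    factor (complex_poly q) L (psi (root1 M ^+ m * w)) z1 z2.

Record puiseux_factorization p (k : nat) (q : 'I_k -> {poly R})
    (L M : 'I_k -> nat) (psi : 'I_k -> R[i] -> R[i])
    (u : R[i] -> R[i] -> R[i]) : Prop := {
  pf_L : forall j, (0 < L j)%N;
  pf_M : forall j, (0 < M j)%N;
  pf_q0 : forall j, (q j).[0] = 0;
  pf_q1 : forall j, 0 < ((q j)^`()).[0];
  pf_degq : forall j, (size (q j) <= 2 * L j)%N;
  pf_psi : forall j, analytic1 (psi j);
  pf_psi0 : forall j, 0 < complex.Im (psi j 0);
  pf_irreducible : forall j, exists W : R[i] -> R[i] -> R[i],
    [/\ irreducible2 W, weierstrass (M j) W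
      & \near0 z1 z2, forall w, w ^+ M j = z1 ->
          branch_prod (q j) (L j) (M j) (psi j) w z1 z2 = W z1 z2];
  pf_u : unit2 u;
  pf_eq : \near0 z1 z2, forall w : 'I_k -> R[i],
    (forall j, w j ^+ M j = z1) ->
    p.[z1, z2] = u z1 z2 *
      \prod_(j < k) branch_prod (q j) (L j) (M j) (psi j) (w j) z1 z2
}.

Definition factors_as p (t : R) (k : nat) (M : 'I_k -> nat)
    (F : forall j, 'I_(M j) -> R[i] -> R[i] -> R[i]) :=
  exists2 u : R[i] -> R[i] -> R[i], unit2 u &
    \near0 z1 z2,
      (polyA p).[z1, z2] + t%:C%C * (polyB p).[z1, z2] =
      u z1 z2 * \prod_(j < k) \prod_(m < M j) F j m z1 z2.

Definition for_almost_all (P : R -> Prop) := finite_set [set t | ~ P t].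

Definition family_factorization p (k : nat) (q : 'I_k -> {poly R})
    (L M : 'I_k -> nat) (psi : forall j, 'I_(M j) -> R -> R[i] -> R[i]) :=
  for_almost_all (fun t =>
    (forall j m, real_analytic1 (psi j m t)) /\
    factors_as p t (fun j m z1 =>
      factor (complex_poly (q j)) (L j) (psi j m t z1) z1)).

(* The (j, m) factor is replaced by the one given by qt, Lt, psit; the other
   factors are kept and the unit is left free. *)
Definition replaceable p (k : nat) (q : 'I_k -> {poly R})
    (L M : 'I_k -> nat) (psi : forall j, 'I_(M j) -> R -> R[i] -> R[i])
    (j : 'I_k) (m : 'I_(M j))
    (Lt : nat) (qt : {poly R[i]}) (psit : R -> R[i] -> R[i]) :=
  for_almost_all (fun t =>
    analytic1 (psit t) /\
    factors_as p t (fun j' (m' : 'I_(M j')) z1 =>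
      if (j' == j) && (m' == m :> nat) then factor qt Lt (psit t z1) z1
      else factor (complex_poly (q j')) (L j') (psi j' m' t z1) z1)).

End Factorizations.

(* Main.v *)
(* Writing c = (1 - i t) / 2, one has A + t B = c p + conj(c) pbar. Fix one of the
   segments z2 = - Q(z1), Q = q_j, with contact order 2 L = 2 L_j, and substitute
   z2 = - Q(z1) + z1^(2 L) w. Each Puiseux factor of p, divided by a suitable power
   of z1, tends for z1 -> 0 to a nonzero constant, to w + r with r real (branches
   following Q beyond order 2 L), or to w + psi_j(0) (branches with the same segment
   and order). So A + t B becomes z1^s G(z1, w) with G a real polynomial and
   G(0, w) = R(w) (c kappa h(w) + conj), where R has real roots and
   h(w) = prod (w + psi_j(0)) has its roots in the lower half plane. By the
   Hermite-Biehler argument the last factor has deg h simple real roots, which for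
   all but finitely many t avoid the roots of R. The implicit function theorem
   continues each of them to a real analytic w(z1). In total this gives as many
   roots z2 of A + t B as there are branches, distinct for z1 <> 0, and dividing
   by them leaves a unit.
   Conversely, a refined segment for the branch (j, m) would force
   c kappa h(- a) + conj(c) conj(kappa) hbar(- a) = 0 with a independent of t, for
   two values of t, hence h(- a) = hbar(- a) = 0; but the roots of h and hbar lie in
   opposite half planes. *)
From mathcomp Require Import separable ring lra zify.
Require Import Defs.
From HB Require Import structures.
From mathcomp Require Import all_boot all_order all_algebra polyXY.
From mathcomp Require Import complex.
From mathcomp Require Import boolp classical_sets functions cardinality reals.
From mathcomp Require Import topology normedtype sequences trigo.
Import Order.TTheory GRing.Theory Num.Theory.
Import numFieldNormedType.Exports.
Local Open Scope classical_set_scope.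
Local Open Scope ring_scope.

Set Implicit Arguments.
Unset Strict Implicit.
Unset Printing Implicit Defensive.

(** * Limits at the origin *)

Lemma near0_comp (R : realType) (P : R[i] -> R[i] -> Prop) (T : Type)
    (F : set_system T) {FF : Filter F} (f g : T -> R[i]^o) :
  (\near0 z1 z2, P z1 z2) -> f @ F --> (0 : R[i]^o) -> g @ F --> (0 : R[i]^o) ->
  \forall x \near F, P (f x) (g x).
Proof.
move=> nP f0 g0.
have fg : (fun x => (f x, g x)) @ F --> ((0 : R[i]^o), (0 : R[i]^o)).
  exact: (cvg_pair f0 g0).
exact: (fg _ nP).
Qed.

Lemma cvg_horner (R : realType) (T : Type) (F : set_system T) {FF : Filter F}
    (p : {poly R[i]}) (f : T -> R[i]^o) (l : R[i]^o) :
  f @ F --> l -> (fun x => p.[f x] : R[i]^o) @ F --> (p.[l] : R[i]^o).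
Proof.
move=> fl; elim/poly_ind: p => [|p c IH].
  rewrite horner0; apply: cvg_near_cst.
  by apply: nearW => x; rewrite horner0.
rewrite hornerMXaddC.
under eq_fun do rewrite hornerMXaddC.
by apply: cvgD; [exact: (@cvgM _ _ F _ _ _ _ _ IH fl) | exact: cvg_cst].
Qed.

Lemma cvg_bigprod (R : realType) (T : Type) (F : set_system T) {FF : Filter F}
    (I : Type) (s : seq I) (P : pred I) (f : I -> T -> R[i]^o) (l : I -> R[i]^o) :
  (forall i, P i -> f i @ F --> l i) ->
  (fun x => \prod_(i <- s | P i) f i x : R[i]^o) @ F -->
    (\prod_(i <- s | P i) l i : R[i]^o).
Proof.
exact: (@cvg_big R[i]^o I *%R 1 P (@mul_continuous _)).
Qed.

Lemma dnbhs_neq0 (R : realType) : \forall z \near (0 : R[i]^o)^', z != 0.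
Proof. exact: nbhs_dnbhs_neq. Qed.

Lemma cvg_id_dnbhs (R : realType) : (fun z : R[i]^o => z) @ (0 : R[i]^o)^' --> (0 : R[i]^o).
Proof. exact: cvg_within. Qed.

Lemma cvg_dist_le (R : realType) (T : Type) (F : set_system T) {FF : ProperFilter F}
    (f : T -> R[i]^o) (l a : R[i]^o) (e : R[i]) :
  f @ F --> l -> (\forall x \near F, `|f x - a| <= e) -> `|l - a| <= e.
Proof.
move=> /cvgrPdist_le fl fa; apply/ler_addgt0Pr => d d0.
near F => x.
rewrite -(subrKA (f x)) addrC (le_trans (ler_normD _ _))// lerD//.
  by near: x.
by near: x; exact: fl.
Unshelve. all: by end_near. Qed.

Lemma geometric_le2 (F : numFieldType) (x : F) n :
  0 <= x -> x <= 2^-1 -> \sum_(i < n) x ^+ i <= 2.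
Proof.
move=> x0 x2.
have x1 : 2^-1 <= 1 - x by rewrite lerBrDr [leRHS](splitr 1) mul1r lerD2l.
have S0 : 0 <= \sum_(i < n) x ^+ i by apply: sumr_ge0 => i _; rewrite exprn_ge0.
have : (1 - x) * \sum_(i < n) x ^+ i <= 1.
  by rewrite -opprB mulNr -subrX1 opprB gerBl exprn_ge0.
move=> /(le_trans (ler_wpM2r S0 x1)).
by rewrite ler_pdivrMl ?ltr0n// mulr1.
Qed.

Lemma near0_singleton (R : realType) (P : R[i] -> R[i] -> Prop) :
  (\near0 z1 z2, P z1 z2) -> P 0 0.
Proof.
by case=> -[U V] [/= /nbhs_singleton U0 /nbhs_singleton V0] /(_ (0, 0)); apply.
Qed.

(** With K the coefficient bound, the (i, j) term is at most K m^(i+j) where |z1|, |z2| <= r m. For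
    g a partial sum of 1 + m + m^2 + ..., the deviation from the constant term is at most K (g -
    1)(g + 1), and m <= 1/2 bounds these factors by 2 m and 3. As m is quantified inside the
    neighbourhood, it can be chosen afterwards. *)
Lemma analytic2_bound (R : realType) (f : R[i] -> R[i] -> R[i]) : analytic2 f ->
  exists r K : R[i], [/\ 0 < r, 0 <= K & \near0 z1 z2, forall m,
    0 <= m -> m <= 2^-1 -> `|z1| <= r * m -> `|z2| <= r * m ->
    `|f z1 z2 - f 0 0| <= K * m].
Proof.
case=> a [[r [K [r0 aK]]] af].
have K0 : 0 <= K.
  by have := aK 0%N 0%N; rewrite expr0 mulr1; exact: le_trans.
have f00 : f 0 0 = a 0%N 0%N.
  have := near0_singleton af.
  move=> /(cvg_unique (@norm_hausdorff _ R[i]^o)); apply.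
  apply: cvg_near_cst; near=> N.
  have N0 : (0 < N)%N by near: N; exact: nbhs_infty_gt.
  rewrite (bigD1 (Ordinal N0))//= (bigD1 (Ordinal N0))//= !expr0 !mulr1.
  rewrite big1 => [|j j0]; last first.
    by rewrite expr0n -[_ == _]/(j == Ordinal N0) (negbTE j0) mulr0.
  rewrite big1 ?addr0// => i i0; rewrite big1// => j _.
  by rewrite expr0n -[_ == _]/(i == Ordinal N0) (negbTE i0) mulr0 mul0r.
exists r, (K * 6); split => //; first by rewrite mulr_ge0.
apply: filterS af => -[z1 z2] /= cf m m0 m2 z1m z2m.
apply: cvg_dist_le cf _; near=> N.
have N0 : (0 < N)%N by near: N; exact: nbhs_infty_gt.
have [n Nn] : exists n, N = n.+1 by exists N.-1; rewrite prednK.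
pose g := \sum_(i < N) m ^+ i.
have g0 : 0 <= g by apply: sumr_ge0 => i _; rewrite exprn_ge0.
have term i j : `|a i j * z1 ^+ i * z2 ^+ j| <= K * (m ^+ i * m ^+ j).
  rewrite !normrM !normrX -mulrA.
  apply: (@le_trans _ _ (`|a i j| * ((r * m) ^+ i * (r * m) ^+ j))).
    apply: ler_wpM2l => //; apply: ler_pM; rewrite ?exprn_ge0//;
      by apply: lerXn2r => //; rewrite nnegrE ?mulr_ge0// ltW.
  rewrite !exprMn mulrACA -(exprD r) (mulrA `|_|).
  by apply: ler_wpM2r => //; rewrite mulr_ge0// exprn_ge0.
have main : `|\sum_(i < N) \sum_(j < N) a i j * z1 ^+ i * z2 ^+ j - f 0 0|
    <= K * (g * g) - K.
  rewrite f00 /g mulr_suml mulr_sumr.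
  under [X in _ <= X - _]eq_bigr do rewrite mulr_sumr mulr_sumr.
  rewrite !pair_bigA/= (bigD1 (Ordinal N0, Ordinal N0))//=.
  rewrite [X in _ <= X - _](bigD1 (Ordinal N0, Ordinal N0))//= !expr0 !mulr1.
  rewrite addrAC subrr add0r addrAC subrr add0r.
  by rewrite (le_trans (ler_norm_sum _ _ _))// ler_sum.
apply: (le_trans main).
have gE : g = 1 + m * \sum_(i < n) m ^+ i.
  rewrite /g Nn big_ord_recl expr0 mulr_sumr; congr (_ + _).
  by apply: eq_bigr => i _; rewrite -exprS.
rewrite -[X in _ - X]mulr1 -mulrBr -mulrA ler_wpM2l//.
rewrite -expr2 subr_sqr_1.
have -> : g - 1 = m * \sum_(i < n) m ^+ i by rewrite gE addrAC subrr add0r.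
rewrite -mulrA [6 * m]mulrC ler_wpM2l// (_ : 6 = 2 * 3); last by rewrite -natrM.
apply: ler_pM.
- by apply: sumr_ge0 => i _; rewrite exprn_ge0.
- by rewrite addr_ge0.
- exact: geometric_le2.
- by rewrite -[3]/((2 + 1)%:R) natrD lerD2r geometric_le2.
Unshelve. all: by end_near. Qed.

Lemma analytic2_cvg (R : realType) (u : R[i] -> R[i] -> R[i]) (T : Type)
    (F : set_system T) {FF : Filter F} (f g : T -> R[i]^o) : analytic2 u ->
  f @ F --> (0 : R[i]^o) -> g @ F --> (0 : R[i]^o) ->
  (fun x => u (f x) (g x) : R[i]^o) @ F --> (u 0 0 : R[i]^o).
Proof.
move=> /analytic2_bound[r [K [r0 K0 bnd]]] f0 g0.
apply/cvgrPdist_le => e e0.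
(* This value gives both m <= 1/2 and K m <= e, also when K = 0. *)
pose m := e / (K + 2 * e).
have D0 : 0 < K + 2 * e by rewrite ltr_wpDl// mulr_gt0.
have m0 : 0 < m by rewrite divr_gt0.
have m2 : m <= 2^-1.
  by rewrite ler_pdivrMr// ler_pdivlMl// lerDr.
have Km : K * m <= e.
  by rewrite mulrCA ler_piMr ?(ltW e0)// ler_pdivrMr// mul1r lerDl mulr_ge0// ltW.
move/cvgrPdist_le : (f0) => /(_ _ (mulr_gt0 r0 m0)) fm.
move/cvgrPdist_le : (g0) => /(_ _ (mulr_gt0 r0 m0)) gm.
have bm := near0_comp (FF := FF) bnd f0 g0.
apply: filterS3 bm fm gm => x bx fx gx.
rewrite distrC (le_trans _ Km)// bx//; first exact: ltW.
  by rewrite -normrN -sub0r.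
by rewrite -normrN -sub0r.
Qed.

(** The coefficient bound comes from one point r > 0 of convergence: each term there is a difference
    of two consecutive partial sums, which are bounded; hence the constant M + M. *)
Lemma analytic1_analytic2 (R : realType) (f : R[i] -> R[i]) :
  analytic1 f -> analytic2 (fun z _ => f z).
Proof.
case=> a af; exists (fun i j => if j == 0%N then a i else 0); split.
  have /nbhs_norm0P[e /= e0 ae] := af.
  pose r := e / 2; have r0 : 0 < r by rewrite divr_gt0.
  have rn : `|r| = r by rewrite gtr0_norm.
  have cr : series (fun n => a n * r ^+ n) @ \oo --> (f r : R[i]^o).
    by apply: ae => /=; rewrite rn ltr_pdivrMr// ltr_pMr// ltr1n.
  have /cvg_seq_bounded/pinfty_ex_gt0[M M0 /= bM] :
    cvgn (series (fun n => a n * r ^+ n) : nat -> R[i]^o) by apply/cvg_ex; exists (f r).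
  exists r, (M + M); split => // i [|j] /=; last first.
    by rewrite normr0 mul0r addr_ge0// ltW.
  rewrite addn0 -{1}rn -normrX -normrM.
  have -> : a i * r ^+ i = series (fun n => a n * r ^+ n) i.+1 -
      series (fun n => a n * r ^+ n) i.
    by rewrite /series/= big_nat_recr//= addrAC subrr add0r.
  by rewrite (le_trans (ler_normB _ _))// lerD// bM.
exists ([set z | series (fun n => a n * z ^+ n) @ \oo --> (f z : R[i]^o)], setT) => /=.
  by split => //; exact: filterT.
move=> -[z1 z2] /= [cf _].
apply: cvg_trans cf; apply: near_eq_cvg; near=> N.
have N0 : (0 < N)%N by near: N; exact: nbhs_infty_gt.
rewrite /series/= big_mkord; apply: eq_bigr => i _.
rewrite (bigD1 (Ordinal N0))//= big1 ?addr0 ?expr0 ?mulr1// => j.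
by rewrite -val_eqE/= => /negbTE ->; rewrite !mul0r.
Unshelve. all: by end_near. Qed.

Lemma analytic1_cvg (R : realType) (f : R[i] -> R[i]) (T : Type)
    (F : set_system T) {FF : Filter F} (g : T -> R[i]^o) : analytic1 f ->
  g @ F --> (0 : R[i]^o) -> (fun x => f (g x) : R[i]^o) @ F --> (f 0 : R[i]^o).
Proof.
move=> /analytic1_analytic2 af g0.
exact: (analytic2_cvg af g0 g0).
Qed.

Lemma real_analytic1_analytic1 (R : realType) (f : R[i] -> R[i]) :
  real_analytic1 f -> analytic1 f.
Proof. by case=> a af; exists (fun n => (a n)%:C%C). Qed.

(** * Leading coefficients as limits of quotients *)

Lemma cvg_poly_div (R : realType) (d : {poly R[i]}) (e : nat) :
  (forall i, (i < e)%N -> d`_i = 0) ->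
  (fun z : R[i]^o => d.[z] / z ^+ e : R[i]^o) @ (0 : R[i]^o)^' --> (d`_e : R[i]^o).
Proof.
move=> d0.
have dE : d = drop_poly e d * 'X^e.
  rewrite -[LHS](poly_take_drop e) (_ : take_poly e d = 0) ?add0r//.
  by apply/polyP => i; rewrite coef_take_poly coef0; case: ifP => // /d0.
have <- : (drop_poly e d).[0] = d`_e by rewrite horner_coef0 coef_drop_poly.
have := cvg_horner (FF := dnbhs_filter _) (p := drop_poly e d) (@cvg_id_dnbhs R).
apply: cvg_trans; apply: near_eq_cvg.
near=> z; rewrite [in RHS]dE hornerM hornerXn mulfK// expf_neq0//.
by near: z; exact: dnbhs_neq0.
Unshelve. all: by end_near. Qed.

Lemma cvg_expr_div (R : realType) (e n : nat) : (e <= n)%N ->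
  (fun z : R[i]^o => z ^+ n / z ^+ e : R[i]^o) @ (0 : R[i]^o)^' -->
    ((n == e)%:R : R[i]^o).
Proof.
move=> en; have -> : (n == e)%:R = ('X^n : {poly R[i]})`_e.
  by rewrite coefXn eq_sym.
have : forall i, (i < e)%N -> ('X^n : {poly R[i]})`_i = 0.
  move=> i ie; rewrite coefXn; case: eqP => // ni.
  by move: ie; rewrite ni ltnNge en.
by move=> /cvg_poly_div; under eq_fun do rewrite hornerXn.
Qed.

(** Strong induction on i < s: the coefficient i is the limit of d(z) / z^i = (d(z) / z^s) (z^s /
    z^i), whose last factor tends to 0. *)
Lemma coef_cvg_div (R : realType) (d : {poly R[i]}) (s : nat) (l : R[i]) :
  (fun z : R[i]^o => d.[z] / z ^+ s : R[i]^o) @ (0 : R[i]^o)^' --> (l : R[i]^o) ->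
  (forall i, (i < s)%N -> d`_i = 0) /\ d`_s = l.
Proof.
move=> dl.
have d0 i : (i < s)%N -> d`_i = 0.
  elim/ltn_ind: i => i IH ls.
  have /cvg_poly_div : forall j, (j < i)%N -> d`_j = 0.
    by move=> j ji; apply: IH => //; exact: ltn_trans ls.
  move=> /(cvg_unique (@norm_hausdorff _ R[i]^o)); apply.
  have := @cvgM _ _ _ (dnbhs_filter _) _ _ _ _ dl (@cvg_expr_div R _ _ (ltnW ls)).
  rewrite (gtn_eqF ls) mulr0; apply: cvg_trans; apply: near_eq_cvg; near=> z.
  by rewrite /= mulrA mulfVK// expf_neq0//; near: z; exact: dnbhs_neq0.
split=> //; have := cvg_poly_div d0.
by move=> /(cvg_unique (@norm_hausdorff _ R[i]^o)); exact.
Unshelve. all: by end_near. Qed.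

Lemma cvg_factor_div (R : realType) (d : {poly R[i]}) (n n' e : nat)
    (w v : R[i] -> R[i]^o) (w0 v0 : R[i]^o) :
  (e <= n)%N -> (e <= n')%N -> (forall i, (i < e)%N -> d`_i = 0) ->
  w @ (0 : R[i]^o)^' --> w0 -> v @ (0 : R[i]^o)^' --> v0 ->
  (fun z : R[i]^o => (z ^+ n * w z + d.[z] + z ^+ n' * v z) / z ^+ e : R[i]^o)
    @ (0 : R[i]^o)^' --> ((n == e)%:R * w0 + d`_e + (n' == e)%:R * v0 : R[i]^o).
Proof.
move=> en en' d0 ww vv.
under eq_fun do rewrite !mulrDl [_ * w _ / _]mulrAC [_ * v _ / _]mulrAC.
apply: cvgD; first apply: cvgD.
- exact: (@cvgM _ _ _ _ _ _ _ _ (@cvg_expr_div R _ _ en) ww).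
- exact: cvg_poly_div.
- exact: (@cvgM _ _ _ _ _ _ _ _ (@cvg_expr_div R _ _ en') vv).
Qed.

(** * Germs with weighted coefficient norms *)

Definition wnorm (K : numDomainType) (r : K) (p : {poly K}) : K :=
  \sum_(i < size p) `|p`_i| * r ^+ i.

Section WeightedNorm.
Variables (K : numDomainType) (r : K).
Hypothesis r0 : 0 <= r.
Implicit Types p q : {poly K}.

Lemma wnorm_wide n p : (size p <= n)%N -> wnorm r p = \sum_(i < n) `|p`_i| * r ^+ i.
Proof.
move=> pn; rewrite /wnorm (big_ord_widen_cond _ xpredT (fun i => `|p`_i| * r ^+ i) pn).
rewrite big_mkcond; apply: eq_bigr => i _ /=; case: ltnP => // pi.
by rewrite nth_default// normr0 mul0r.
Qed.

Lemma wnorm_ge0 p : 0 <= wnorm r p.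
Proof. by apply: sumr_ge0 => i _; rewrite mulr_ge0// exprn_ge0. Qed.

Lemma wnorm0 : wnorm r 0 = 0.
Proof. by rewrite /wnorm size_poly0 big_ord0. Qed.

Lemma wnormC c : wnorm r c%:P = `|c|.
Proof.
by rewrite (wnorm_wide (size_polyC_leq1 c)) big_ord1 coefC eqxx expr0 mulr1.
Qed.

Lemma wnormD p q : wnorm r (p + q) <= wnorm r p + wnorm r q.
Proof.
have [pn qn] := (leq_maxl (size p) (size q), leq_maxr (size p) (size q)).
rewrite (wnorm_wide pn) (wnorm_wide qn) (wnorm_wide (size_polyD p q)).
rewrite -big_split; apply: ler_sum => i _ /=.
by rewrite -mulrDl coefD ler_wpM2r ?exprn_ge0// ler_normD.
Qed.

Lemma wnormN p : wnorm r (- p) = wnorm r p.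
Proof. by rewrite /wnorm size_polyN; apply: eq_bigr => i _; rewrite coefN normrN. Qed.

Lemma wnormB p q : wnorm r (p - q) <= wnorm r p + wnorm r q.
Proof. by rewrite -(wnormN q) wnormD. Qed.

Lemma wnorm_sum I (s : seq I) (F : I -> {poly K}) :
  wnorm r (\sum_(i <- s) F i) <= \sum_(i <- s) wnorm r (F i).
Proof.
elim/big_rec2: _ => [|i x y _ le_yx]; first by rewrite wnorm0.
by rewrite (le_trans (wnormD _ _))// lerD2l.
Qed.

Lemma wnorm_le_coef p q : (forall i, `|p`_i| <= `|q`_i|) -> wnorm r p <= wnorm r q.
Proof.
move=> pq; have [pn qn] := (leq_maxl (size p) (size q), leq_maxr (size p) (size q)).
rewrite (wnorm_wide pn) (wnorm_wide qn); apply: ler_sum => i _.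
by rewrite ler_wpM2r// exprn_ge0.
Qed.

Lemma wnormM p q : wnorm r (p * q) <= wnorm r p * wnorm r q.
Proof.
(* The weighted norm is the value at r of the majorant with coefficients |f_i|, so the claim reduces
   to the triangle inequality in each coefficient. *)
pose abs (f : {poly K}) := \poly_(i < size f) `|f`_i|.
have absE f : wnorm r f = (abs f).[r] by rewrite horner_poly.
have coef_abs f i : (abs f)`_i = `|f`_i|.
  by rewrite coef_poly; case: ltnP => // fi; rewrite nth_default// normr0.
rewrite (absE p) (absE q) -hornerM.
have pq := leq_maxl (size (p * q)) (size (abs p * abs q)).
have apq := leq_maxr (size (p * q)) (size (abs p * abs q)).
rewrite (wnorm_wide pq) (horner_coef_wide _ apq); apply: ler_sum => i _.
rewrite ler_wpM2r ?exprn_ge0// !coefM (le_trans (ler_norm_sum _ _ _))//.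
by apply: ler_sum => j _; rewrite normrM !coef_abs.
Qed.

Lemma wnormX p n : wnorm r (p ^+ n) <= wnorm r p ^+ n.
Proof.
elim: n => [|n IH]; first by rewrite !expr0 -polyC1 wnormC normr1.
by rewrite !exprS (le_trans (wnormM _ _))//; apply: ler_wpM2l => //; exact: wnorm_ge0.
Qed.

Lemma le_wnorm s p : s <= r -> 0 <= s -> wnorm s p <= wnorm r p.
Proof.
move=> sr s0; apply: ler_sum => i _; rewrite ler_wpM2l//.
by rewrite lerXn2r// nnegrE.
Qed.

End WeightedNorm.

(** A Schwarz-type estimate: for |z| <= r / 2 the gain (|z| / r)^n is at most 2^-n, the source of
    the geometric convergence of germs. *)
Lemma norm_horner_le (K : numFieldType) (r z : K) (n : nat) (p : {poly K}) :
  0 < r -> `|z| <= r -> (forall i, (i < n)%N -> p`_i = 0) ->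
  `|p.[z]| <= (`|z| / r) ^+ n * wnorm r p.
Proof.
move=> r0 zr p0; rewrite horner_coef (le_trans (ler_norm_sum _ _ _))//.
rewrite /wnorm mulr_sumr; apply: ler_sum => i _.
have [/p0 ->|ni] := ltnP i n; first by rewrite mul0r normr0 mul0r mulr0.
rewrite normrM normrX mulrCA ler_wpM2l//.
have zr0 : 0 <= `|z| / r by rewrite divr_ge0// ltW.
have -> : `|z| ^+ i = (`|z| / r) ^+ i * r ^+ i by rewrite -exprMn mulfVK// gt_eqF.
apply: ler_wpM2r; first by rewrite exprn_ge0// ltW.
by apply: ler_wiXn2l => //; rewrite ler_pdivrMr// mul1r.
Qed.

(** Shrinking the radius from 1 to r gains a factor r on each monomial of positive degree; this
    supplies the smallness in the Picard iteration. *)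
Lemma wnorm_const0 (K : numFieldType) (r : K) (p : {poly K}) :
  0 <= r -> r <= 1 -> p`_0 = 0 -> wnorm r p <= r * wnorm 1 p.
Proof.
move=> r0 r1 p0; rewrite /wnorm mulr_sumr; apply: ler_sum => -[[|i] /= ip] _.
  by rewrite p0 normr0 !mul0r mulr0.
rewrite expr1n mulr1 mulrC ler_wpM2r// exprS -[leRHS]mulr1.
by rewrite ler_wpM2l// exprn_ile1.
Qed.

(* A convergent power series is represented by polynomials A N that agree with it
   below degree N and whose weighted l^1 norms are bounded: sums and products of
   germs are then sums and products of polynomials, and Picard iterates qualify. *)
Definition germ_of (R : realType) (A : nat -> {poly R[i]}) (g : R[i] -> R[i]) (r : R[i]) :=
  [/\ 0 < r,
      exists K, forall N, wnorm r (A N) <= K,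
      forall N i, (i < N)%N -> (A N.+1)`_i = (A N)`_i
    & forall z, `|z| <= r / 2 -> (fun N => (A N).[z]) @ \oo --> (g z : R[i]^o)].

Definition germ (R : realType) (g : R[i] -> R[i]) := exists A r, germ_of A g r.

Section Germs.
Variable R : realType.
Implicit Types (A B : nat -> {poly R[i]}) (f g : R[i] -> R[i]) (p : {poly R[i]}).

Lemma germ_of_le A g r s : germ_of A g r -> 0 < s -> s <= r -> germ_of A g s.
Proof.
move=> [r0 [K AK] Ai Ag] s0 sr; split=> //.
  by exists K => N; rewrite (le_trans _ (AK N))// le_wnorm// ltW.
by move=> z zs; apply: Ag; rewrite (le_trans zs)// ler_pM2r// invr_gt0 ltr0n.
Qed.

Lemma exists_gt0_le2 (r s : R[i]) : 0 < r -> 0 < s ->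
  exists t, [/\ 0 < t, t <= r & t <= s].
Proof.
move=> r0 s0; have /orP[rs|sr] := real_leVge (gtr0_real r0) (gtr0_real s0).
  by exists r.
by exists s.
Qed.

Lemma germ_poly p : germ (fun z => p.[z]).
Proof.
exists (fun _ => p), 1; split=> //; first by exists (wnorm 1 p).
by move=> z _; exact: (@cvg_cst R[i]^o).
Qed.

Lemma germD f g : germ f -> germ g -> germ (fun z => f z + g z).
Proof.
move=> [A [r Af]] [B [s Bg]].
have [r0 _ _ _] := Af; have [s0 _ _ _] := Bg.
have [t [t0 tr ts]] := exists_gt0_le2 r0 s0.
have [_ [K AK] Ai {}Af] := germ_of_le Af t0 tr.
have [_ [L BL] Bi {}Bg] := germ_of_le Bg t0 ts.
exists (fun N => A N + B N), t; split; first exact: t0.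
- by exists (K + L) => N; rewrite (le_trans (wnormD (ltW t0) _ _))// lerD.
- by move=> N i iN; rewrite !coefD Ai// Bi.
- move=> z zt; under eq_fun do rewrite hornerD.
  exact: (@cvgD _ R[i]^o _ _ _ _ _ _ _ (Af z zt) (Bg z zt)).
Qed.

Lemma germM f g : germ f -> germ g -> germ (fun z => f z * g z).
Proof.
move=> [A [r Af]] [B [s Bg]].
have [r0 _ _ _] := Af; have [s0 _ _ _] := Bg.
have [t [t0 tr ts]] := exists_gt0_le2 r0 s0.
have [_ [K AK] Ai {}Af] := germ_of_le Af t0 tr.
have [_ [L BL] Bi {}Bg] := germ_of_le Bg t0 ts.
exists (fun N => A N * B N), t; split; first exact: t0.
- exists (K * L) => N; rewrite (le_trans (wnormM (ltW t0) _ _))//.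
  by apply: ler_pM => //; apply: wnorm_ge0; exact: ltW.
- move=> N i iN; rewrite !coefM; apply: eq_bigr => -[j /= ji] _.
  rewrite Ai ?Bi//; first by rewrite (leq_ltn_trans (leq_subr _ _)).
  by rewrite (leq_trans _ iN).
- move=> z zt; under eq_fun do rewrite hornerM.
  exact: (@cvgM _ _ _ _ _ _ _ _ (Af z zt) (Bg z zt)).
Qed.

Lemma germ_sum (I : Type) (s : seq I) (P : pred I) (F : I -> R[i] -> R[i]) :
  (forall i, P i -> germ (F i)) -> germ (fun z => \sum_(i <- s | P i) F i z).
Proof.
move=> gF; elim: s => [|i s IH].
  rewrite (_ : (fun z => _) = fun z => (0 : {poly R[i]}).[z]); first exact: germ_poly.
  by apply/funext => z; rewrite big_nil horner0.
case Pi : (P i); last first.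
  by under eq_fun do rewrite big_cons Pi.
under eq_fun do rewrite big_cons Pi.
by apply: germD; [exact: gF | exact: IH].
Qed.

Lemma coef_germ_of A g r N i : germ_of A g r -> (i < N)%N -> (A N)`_i = (A i.+1)`_i.
Proof.
case=> _ _ Ai _; elim: N => // N IH; rewrite ltnS leq_eqVlt => /predU1P[->//|iN].
by rewrite Ai// IH.
Qed.

Lemma cvg_geometric_half : (fun n => (2^-1 : R[i]) ^+ n : R[i]^o) @ \oo --> (0 : R[i]^o).
Proof.
apply/cvgr0Pnorm_lt => e; rewrite ltcE /= => /andP[/eqP e1 e0].
have : (fun n => (2^-1 : R) ^+ n) @ \oo --> (0 : R).
  by apply: cvg_expr; rewrite gtr0_norm ?invr_gt0 ?ltr0n// invf_lt1 ?ltr0n// ltr1n.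
move=> /cvgr0Pnorm_lt /(_ _ e0); apply: filterS => n.
have -> : (2^-1 : R[i]) ^+ n = ((2^-1 : R) ^+ n)%:C%C.
  by rewrite rmorphXn fmorphV rmorph_nat.
by rewrite normc_def ltcE /= e1 eqxx expr0n addr0 sqrtr_sqr.
Qed.

(** The coefficient of z^n is stable from [A n.+1] on. Hence [A N] and the N-th partial sum differ
    only in degrees at least N, and the half radius makes this difference at most K 2^-N. *)
Lemma germ_of_series A g r z : germ_of A g r -> `|z| <= r / 2 ->
  series (fun n => (A n.+1)`_n * z ^+ n) @ \oo --> (g z : R[i]^o).
Proof.
move=> Ag zr; have [r0 [K AK] _ {}/(_ z zr) gz] := (Ag).
have r2 : `|z| <= r by rewrite (le_trans zr)// ler_pdivrMr// ler_peMr ?(ltW r0)// ler1n.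
have zr2 : `|z| / r <= 2^-1 by rewrite ler_pdivrMr// mulrC.
have K0 : 0 <= K by apply: le_trans (AK 0%N); exact: wnorm_ge0 (ltW r0) _.
have tail : (fun N => series (fun n => (A n.+1)`_n * z ^+ n) N - (A N).[z]) @ \oo -->
    (0 : R[i]^o).
  apply/(@cvgr0Pnorm_le _ R[i]^o) => e e0.
  have : (fun n => K * (2^-1 : R[i]) ^+ n : R[i]^o) @ \oo --> (0 : R[i]^o).
    rewrite -(mulr0 K); exact: (@cvgMl_tmp _ _ _ _ _ K _ cvg_geometric_half).
  move=> /cvgr0Pnorm_le/(_ _ e0); apply: filterS => N.
  apply: le_trans; rewrite normrM (ger0_norm K0) normrX.
  rewrite (gtr0_norm (x := 2^-1)) ?invr_gt0 ?ltr0n//.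
  have -> : series (fun n => (A n.+1)`_n * z ^+ n) N = (take_poly N (A N)).[z].
    rewrite horner_poly /series/= big_mkord; apply: eq_bigr => i _.
    by rewrite (coef_germ_of Ag (ltn_ord i)).
  rewrite -hornerN -hornerD mulrC.
  have -> : take_poly N (A N) - A N = - (A N - take_poly N (A N)) by rewrite opprB.
  rewrite hornerN normrN.
  apply: (le_trans (norm_horner_le (n := N) r0 r2 _)) => [i iN|].
    by rewrite coefB coef_take_poly iN subrr.
  apply: ler_pM; [by rewrite exprn_ge0// divr_ge0// ltW | exact: wnorm_ge0 (ltW r0) _| |].
    by apply: lerXn2r => //; rewrite nnegrE ?invr_ge0 ?ler0n// divr_ge0// ltW.
  apply: le_trans (AK N); apply: wnorm_le_coef; first exact: ltW.
  move=> i.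
  by rewrite coefB coef_take_poly; case: ifP => _; rewrite ?subrr ?normr0// subr0.
have : (fun N => series (fun n => (A n.+1)`_n * z ^+ n) N - (A N).[z] + (A N).[z])
    @ \oo --> (0 + g z : R[i]^o).
  exact: (@cvgD _ R[i]^o _ _ _ _ _ _ _ tail gz).
by rewrite add0r; under eq_fun do rewrite subrK.
Qed.

Lemma germ_of_near A g r : germ_of A g r ->
  \forall z \near (0 : R[i]^o), `|z| <= r / 2.
Proof. by case=> r0 _ _ _; apply: nbhs0_le; rewrite divr_gt0. Qed.

Lemma germ_analytic1 g : germ g -> analytic1 g.
Proof.
move=> [A [r Ag]]; exists (fun n => (A n.+1)`_n).
by apply: filterS (germ_of_near Ag) => z; exact: germ_of_series.
Qed.

Lemma conjc_fix_Re (x : R[i]) : (x^*)%C = x -> (complex.Re x)%:C%C = x.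
Proof.
case: x => a b [] /eqP; rewrite -subr_eq0 -opprD oppr_eq0 -mulr2n mulrn_eq0 /=.
by move=> /eqP ->.
Qed.

Lemma germ_real_analytic1 A g r : (forall N, map_poly (@conjc R) (A N) = A N) ->
  germ_of A g r -> real_analytic1 g.
Proof.
move=> Areal Ag; exists (fun n => complex.Re (A n.+1)`_n).
apply: filterS (germ_of_near Ag) => z /(germ_of_series Ag).
rewrite (_ : (fun n => (complex.Re _)%:C%C * _) = (fun n => (A n.+1)`_n * z ^+ n))//.
by apply/funext => n; rewrite conjc_fix_Re// -[in RHS]Areal coef_map.
Qed.

Lemma germ_cvg g (T : Type) (F : set_system T) {FF : Filter F} (h : T -> R[i]^o) :
  germ g -> h @ F --> (0 : R[i]^o) -> (fun x => g (h x) : R[i]^o) @ F --> (g 0 : R[i]^o).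
Proof. by move=> /germ_analytic1 ga h0; exact: (analytic1_cvg ga h0). Qed.

Lemma germ_eq0 g : germ g -> (\forall z \near (0 : R[i]^o)^', g z = 0) ->
  \forall z \near (0 : R[i]^o), g z = 0.
Proof.
move=> gg g0.
have gc := @germ_cvg _ _ _ (dnbhs_filter _) _ gg (@cvg_id_dnbhs R).
have g00 : g 0 = 0.
  apply: (cvg_unique (@norm_hausdorff _ R[i]^o)) gc _.
  by apply: cvg_near_cst; apply: filterS g0.
have : \forall z \near (0 : R[i]^o), z != 0 -> g z = 0 by [].
apply: filterS => z.
by move=> h; have [->|/h] := eqVneq z 0.
Qed.

End Germs.

(** * Completeness, and germs from polynomial sequences with stable coefficients *)

Section Completeness.
Variable R : realType.

Lemma cvg_of_geometric_real (v : nat -> R) (k : R) :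
  (forall n, `|v n.+1 - v n| <= k * 2^-1 ^+ n) -> exists l : R, v @ \oo --> l.
Proof.
move=> vk; suff : cvgn v by move=> /cvg_ex.
have -> : v = cst (v 0%N) + series (telescope v).
  by apply/funext => n; rewrite [LHS]eq_sum_telescope.
apply: is_cvgD; first exact: is_cvg_cst.
apply: normed_cvg.
apply: (@series_le_cvg _ _ (geometric k 2^-1)).
- by move=> n /=.
- by move=> n; apply: le_trans (vk n).
- by move=> n; exact: vk.
- apply: is_cvg_geometric_series.
  by rewrite gtr0_norm ?invr_gt0 ?ltr0n// invf_lt1 ?ltr0n// ltr1n.
Qed.

Lemma cvg_real_complex (a : nat -> R) (l : R) : a @ \oo --> l ->
  (fun n => (a n)%:C%C : R[i]^o) @ \oo --> (l%:C%C : R[i]^o).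
Proof.
move=> al; apply/cvgrPdist_le => e; rewrite ltcE /= => /andP[/eqP e1 e0].
move/cvgrPdist_le : al => /(_ _ e0); apply: filterS => n.
by rewrite -rmorphB normc_def lecE /= e1 eqxx expr0n addr0 sqrtr_sqr.
Qed.

Lemma cvg_of_geometric (u : nat -> R[i]) (k : R) :
  (forall n, `|u n.+1 - u n| <= (k * 2^-1 ^+ n)%:C%C) ->
  exists l, u @ \oo --> (l : R[i]^o).
Proof.
move=> uk.
have [a al] : exists l : R, (fun n => complex.Re (u n)) @ \oo --> l.
  apply: (cvg_of_geometric_real (k := k)) => n.
  by rewrite -raddfB -lecR (le_trans (normc_ge_Re _)).
have [b bl] : exists l : R, (fun n => complex.Im (u n)) @ \oo --> l.
  apply: (cvg_of_geometric_real (k := k)) => n.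
  rewrite -raddfB -normrN -ReiNIm -lecR (le_trans (normc_ge_Re _))//.
  rewrite normrM (_ : `|'i%C| = 1) ?mulr1//.
  by rewrite normc_def /= expr0n add0r expr1n sqrtr1.
exists (a%:C%C + 'i%C * b%:C%C).
have -> : u = fun n => (complex.Re (u n))%:C%C + 'i%C * (complex.Im (u n))%:C%C.
  by apply/funext => n; rewrite -complexE.
have cb : (fun n => 'i%C * (complex.Im (u n))%:C%C : R[i]^o) @ \oo -->
    ('i%C * b%:C%C : R[i]^o).
  exact: (@cvgMl_tmp _ _ _ _ _ ('i%C : R[i]^o) _ (cvg_real_complex bl)).
exact: (@cvgD _ R[i]^o _ _ _ _ _ _ _ (cvg_real_complex al) cb).
Qed.

(** Consecutive polynomials agree below degree N and differ by at most 2 K in norm, so on |z| <= r /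
    2 their values differ by at most 2 K 2^-N and converge. *)
Lemma germ_of_exists (A : nat -> {poly R[i]}) (r K : R[i]) : 0 < r ->
  (forall N, wnorm r (A N) <= K) ->
  (forall N i, (i < N)%N -> (A N.+1)`_i = (A N)`_i) ->
  exists g, germ_of A g r.
Proof.
move=> r0 AK Ai.
have K0 : 0 <= K by apply: le_trans (AK 0%N); exact: wnorm_ge0 (ltW r0) _.
have KE : K = (complex.Re K)%:C%C by rewrite RRe_real// ger0_real.
have cvA z : exists l : R[i]^o, `|z| <= r / 2 -> (fun N => (A N).[z]) @ \oo --> l.
  have [zr|] := pselect (`|z| <= r / 2); last by exists 0.
  suff [l Al] : exists l, (fun N => (A N).[z]) @ \oo --> (l : R[i]^o) by exists l.
  apply: (@cvg_of_geometric _ (complex.Re K + complex.Re K)) => n.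
  have r2 : `|z| <= r by rewrite (le_trans zr)// ler_pdivrMr// ler_peMr ?(ltW r0)// ler1n.
  have zr2 : `|z| / r <= 2^-1 by rewrite ler_pdivrMr// mulrC.
  rewrite -hornerN -hornerD.
  apply: (le_trans (norm_horner_le (n := n) r0 r2 _)) => [i iN|].
    by rewrite coefB Ai// subrr.
  have -> : ((complex.Re K + complex.Re K) * 2^-1 ^+ n)%:C%C = 2^-1 ^+ n * (K + K).
    by rewrite [in RHS]KE -rmorphD mulrC rmorphM rmorphXn fmorphV rmorph_nat.
  apply: ler_pM; [by rewrite exprn_ge0// divr_ge0// ltW|exact: wnorm_ge0 (ltW r0) _| |].
    by apply: lerXn2r => //; rewrite nnegrE ?invr_ge0 ?ler0n// divr_ge0// ltW.
  by rewrite (le_trans (wnormB (ltW r0) _ _))// lerD.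
have [g gP] := choice cvA; exists g; split; [by []|by exists K|by []|exact: gP].
Qed.

End Completeness.

(** * Implicit functions *)

Lemma horner2_horner (K : comNzRingType) (p : {poly {poly K}}) (a : {poly K}) (z : K) :
  p.[a].[z] = p.[a.[z], z].
Proof.
rewrite -[LHS]/(horner_eval z p.[a]) -[RHS]/(horner_eval z p.[(a.[z])%:P]).
rewrite -[LHS](horner_map (horner_eval z)) -[RHS](horner_map (horner_eval z)).
by rewrite /= /horner_eval hornerC.
Qed.

Lemma horner2_map_poly (K : comNzRingType) (p : {poly {poly K}}) (y z : K) :
  p.[y, z] = (map_poly (horner_eval z) p).[y].
Proof. by rewrite -[LHS](horner_map (horner_eval z)) /= /horner_eval hornerC. Qed.

Section ImplicitFunction.
Variable R : realType.
Implicit Types (a b : {poly R[i]}) (P : {poly {poly R[i]}}).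

(* Substitution into P is a contraction for the X-adic distance on series without
   constant term, because P has no linear term at the origin. *)
Lemma coef_horner_diff P a b N i : P`_1`_0 = 0 -> a`_0 = 0 -> b`_0 = 0 ->
  (forall j, (j < N)%N -> a`_j = b`_j) -> (i < N.+1)%N -> P.[a]`_i = P.[b]`_i.
Proof.
move=> P1 a0 b0 ab iN.
have : root (P - P.[b]%:P) b by rewrite rootE !hornerE subrr.
move=> /factor_theorem[q qE].
have PE : P = q * ('X - b%:P) + P.[b]%:P by rewrite -qE subrK.
have q0 : q.[0, 0] = 0.
  have : P^`().[b].[0] = 0.
    by rewrite horner2_horner [b.[0]]horner_coef0 b0 polyC0 !horner_coef0 coef_deriv mulr1n.
  rewrite {1}PE derivD derivC addr0 derivM derivXsubC mulr1 hornerD hornerM.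
  rewrite hornerXsubC subrr mulr0 add0r horner2_horner [b.[0]]horner_coef0 b0.
  exact: id.
have -> : P.[a] = (a - b) * q.[a] + P.[b] by rewrite {1}PE !hornerE mulrC.
rewrite coefD coefM big1 ?add0r// => -[j /= ji] _.
have [jN|Nj] := ltnP j N; first by rewrite coefB ab// subrr mul0r.
have -> : (i - j)%N = 0%N by apply/eqP; rewrite subn_eq0 (leq_trans _ Nj)// -ltnS.
by rewrite -[q.[a]`_0]horner_coef0 horner2_horner [a.[0]]horner_coef0 a0 q0 mulr0.
Qed.

(** At radius r = s^2, the coefficients of index 0 and 1 gain s^2 from having no constant term, and
    the term of degree j >= 2 gains s^j <= s^2. The total is at most B0 s^2, which is at most s for
    s = 1 / (2 (B0 + 1)). *)
Lemma wnorm_horner_le P : P`_0`_0 = 0 -> P`_1`_0 = 0 ->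
  exists r s : R[i], 0 < r /\ (forall a, wnorm r a <= s -> wnorm r P.[a] <= s) /\ 0 <= s.
Proof.
move=> P0 P1.
pose B0 := \sum_(j < size P) wnorm 1 P`_j.
have B00 : 0 <= B0 by apply: sumr_ge0 => j _; exact: wnorm_ge0.
pose s : R[i] := (2 * (B0 + 1))^-1.
have B1 : 0 < 2 * (B0 + 1) by rewrite mulr_gt0// ltr_wpDl.
have s0 : 0 < s by rewrite invr_gt0.
have s1 : s <= 1.
  by rewrite invf_le1// mulrDr mulr1 ler_wpDl ?mulr_ge0// ler1n.
exists (s ^+ 2), s; split; first by rewrite exprn_gt0.
split; last exact: ltW.
have r0 : 0 <= s ^+ 2 by rewrite exprn_ge0// ltW.
have r1 : s ^+ 2 <= 1 by rewrite exprn_ile1// ltW.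
move=> a as_; rewrite horner_coef.
have term (j : 'I_(size P)) :
    wnorm (s ^+ 2) (P`_j * a ^+ j) <= wnorm 1 P`_j * (s ^+ 2).
  apply: (le_trans (wnormM r0 _ _)).
  have aj : wnorm (s ^+ 2) (a ^+ j) <= s ^+ j.
    apply: (le_trans (wnormX r0 _ _)); apply: lerXn2r => //.
      by rewrite nnegrE wnorm_ge0.
    by rewrite nnegrE ltW.
  apply: (@le_trans _ _ (wnorm (s ^+ 2) P`_j * s ^+ j)).
    by apply: ler_wpM2l => //; exact: wnorm_ge0.
  have small i : P`_i`_0 = 0 -> wnorm (s ^+ 2) P`_i * s ^+ i <= wnorm 1 P`_i * s ^+ 2.
    move=> Pi; apply: (@le_trans _ _ (wnorm (s ^+ 2) P`_i * 1)).
      by apply: ler_wpM2l; [exact: wnorm_ge0|rewrite exprn_ile1// ltW].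
    by rewrite mulr1 [leRHS]mulrC wnorm_const0.
  case: j aj => -[|[|j]] /= _ _; [exact: small|exact: small|].
  apply: ler_pM; [exact: wnorm_ge0|by rewrite exprn_ge0// ltW| |].
    by apply: le_wnorm.
  by apply: ler_wiXn2l => //; exact: ltW.
apply: (le_trans (wnorm_sum r0 _ _)); apply: (le_trans (ler_sum _ (fun j _ => term j))).
rewrite -mulr_suml -/B0 expr2 mulrA ler_piMl ?(ltW s0)//.
rewrite /s ler_pdivrMr// mul1r mulrDr mulr1 ler_wpDr//.
by rewrite ler_peMl// ler1n.
Qed.

(** Picard iteration of a -> P(a) from 0: each step settles one more coefficient, the weighted norms
    stay bounded, and the invariance of P under conjugation passes to every iterate. *)
Lemma fixed_point_germ P : P`_0`_0 = 0 -> P`_1`_0 = 0 ->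
  conj_poly P = P ->
  exists A r g, [/\ forall N, map_poly (@conjc R) (A N) = A N, germ_of A g r, g 0 = 0
    & forall z, `|z| <= r / 2 -> g z = P.[g z, z]].
Proof.
move=> P0 P1 Preal.
have [r [s [r0 [Ps s0]]]] := wnorm_horner_le P0 P1.
pose A N : {poly R[i]} := iter N (horner P) 0.
have As N : wnorm r (A N) <= s by elim: N => [|N IH]; [rewrite wnorm0|exact: Ps].
have A0 N : (A N)`_0 = 0.
  elim: N => [|N IH]; first by rewrite coef0.
  rewrite /= -horner_coef0 horner2_horner [(iter _ _ _).[0]]horner_coef0 IH.
  by rewrite polyC0 !horner_coef0.
have Ai N i : (i < N)%N -> (A N.+1)`_i = (A N)`_i.
  elim: N i => // N IH i iN; exact: coef_horner_diff IH iN.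
have [g Ag] := germ_of_exists r0 As Ai.
exists A, r, g; split => //.
- elim=> [|N IH]; first by rewrite /= rmorph0.
  by rewrite /= -horner_map /= IH -[in RHS]Preal.
- have [_ _ _ /(_ 0)] := Ag; rewrite normr0 divr_ge0// ?ltW// => /(_ isT).
  move=> /(cvg_unique (@norm_hausdorff _ R[i]^o)); apply.
  by apply: cvg_near_cst; apply: nearW => N; rewrite horner_coef0 A0.
move=> z zr; have [_ _ _ /(_ z zr) gz] := Ag.
have : (fun N => (A N.+1).[z]) @ \oo --> (g z : R[i]^o).
  by rewrite (cvg_shiftS (fun N => (A N).[z] : R[i]^o)).
move=> /(cvg_unique (@norm_hausdorff _ R[i]^o)); apply.
rewrite horner2_map_poly /=; apply: cvg_trans (cvg_horner gz).
apply: near_eq_cvg; apply: nearW => N.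
by rewrite -horner2_map_poly -horner2_horner.
Qed.

Lemma implicit_function_germ P (w0 : R[i]) :
  conj_poly P = P -> (w0^*)%C = w0 ->
  P.[w0, 0] = 0 -> P^`().[w0, 0] != 0 ->
  exists A r g, [/\ forall N, map_poly (@conjc R) (A N) = A N, germ_of A g r, g 0 = w0
    & \forall z \near (0 : R[i]^o), P.[g z, z] = 0].
Proof.
move=> Preal wreal P0 P1.
pose d := P^`().[w0, 0].
pose c : {poly R[i]} := w0%:P.
pose S := P \Po ('X + c%:P).
(* Newton's map with frozen derivative, after moving w0 to the origin: fixed points of [Phi] are
   zeros of [S], and the factor 1 / d cancels the linear coefficient at the origin. *)
pose Phi : {poly {poly R[i]}} := 'X - (d^-1)%:P%:P * S.
have S0 : S`_0 = P.[c] by rewrite -horner_coef0 horner_comp !hornerE.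
have S1 : S`_1 = P^`().[c].
  have -> : S`_1 = S^`()`_0 by rewrite coef_deriv.
  rewrite -[S^`()`_0]horner_coef0 /S deriv_comp derivD derivX derivC addr0 mulr1.
  by rewrite horner_comp hornerD hornerX hornerC add0r.
have cS : conj_poly S = S.
  rewrite /conj_poly /S map_comp_poly -/(conj_poly P) Preal rmorphD /= map_polyX.
  by rewrite !map_polyC /= map_polyC /= wreal.
have dreal : (d^*)%C = d.
  rewrite /d -horner_map rmorph0 /= -horner_map /= map_polyC /= wreal.
  by rewrite -deriv_map -/(conj_poly P) Preal.
have Phi0 : Phi`_0`_0 = 0.
  rewrite /Phi coefB coefX coefCM S0 coefB coefCM -[P.[c]`_0]horner_coef0 P0.
  by rewrite mulr0 subr0 coef0.
have Phi1 : Phi`_1`_0 = 0.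
  rewrite /Phi coefB coefX coefCM S1 coefB coefCM -[P^`().[c]`_0]horner_coef0.
  by rewrite mulVf// coef1 subrr.
have Phireal : conj_poly Phi = Phi.
  rewrite /conj_poly rmorphB rmorphM /= map_polyX -/(conj_poly S) cS.
  by rewrite !map_polyC /= map_polyC /= conjc_inv dreal.
have [A [r [g [Areal Ag g0 gP]]]] := fixed_point_germ Phi0 Phi1 Phireal.
exists (fun N => A N + c), r, (fun z => g z + w0); split.
- by move=> N; rewrite rmorphD /= Areal map_polyC /= wreal.
- have [r0 [K AK] Ai Az] := Ag; split; first exact: r0.
  + exists (K + `|w0|) => N.
    by rewrite (le_trans (wnormD (ltW r0) _ _))// wnormC lerD2r.
  + by move=> N i iN; rewrite !coefD Ai.
  + move=> z zr; under eq_fun do rewrite hornerD hornerC.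
    by apply: (@cvgD _ R[i]^o _ _ _ _ _ _ _ (Az z zr)); exact: (@cvg_cst R[i]^o).
- by rewrite g0 add0r.
apply: filterS (germ_of_near Ag) => z /gP; rewrite /Phi !hornerE /= => /eqP.
rewrite eq_sym -subr_eq0 addrAC subrr add0r oppr_eq0 mulf_eq0 invr_eq0 (negbTE P1) /=.
by rewrite /S horner_comp hornerD hornerX hornerC -polyCD => /eqP.
Qed.

End ImplicitFunction.

(** * Hermite-Biehler *)

Section HermiteBiehler.
Variable R : realType.
Implicit Types (x z a c : R[i]) (ps : seq R[i]).

Lemma normB_conj_lt z a : 0 < complex.Im z -> complex.Im a < 0 ->
  `|z - (a^*)%C| < `|z - a|.
Proof.
case: z a => [x y] [b d] /= y0 d0.
rewrite !normc_def /= ltcR ltr_sqrt; last first.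
  by rewrite ltr_wpDl ?sqr_ge0// exprn_gt0// subr_gt0 (lt_trans d0).
rewrite ltrD2l opprK !expr2.
by nra.
Qed.

Lemma prod_normB_conj_lt z ps : ps != [::] -> 0 < complex.Im z ->
  (forall a, a \in ps -> complex.Im a < 0) ->
  `|\prod_(a <- ps) (z - (a^*)%C)| < `|\prod_(a <- ps) (z - a)|.
Proof.
move=> ps0 z0 psI; rewrite !normr_prod !big_seq; apply: ltr_prod.
  by case: ps ps0 {psI} => //= a ps _; rewrite mem_head.
by move=> a /psI a0; rewrite normr_ge0 normB_conj_lt.
Qed.

Definition real_part2 (p : {poly R[i]}) : {poly R[i]} := p + map_poly (@conjc R) p.

Lemma Im_inv_lt0 z : 0 < complex.Im z -> complex.Im z^-1 < 0.
Proof.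
case: z => x y /= y0; rewrite oppr_lt0 divr_gt0//.
by rewrite ltr_wpDl ?sqr_ge0// exprn_gt0.
Qed.

Lemma deriv_prod_XsubC_horner ps z : z \notin ps ->
  (\prod_(a <- ps) ('X - a%:P))^`().[z] =
  (\prod_(a <- ps) ('X - a%:P)).[z] * \sum_(a <- ps) (z - a)^-1.
Proof.
elim: ps => [|a ps IH]; first by rewrite !big_nil derivC horner0 mulr0.
rewrite inE negb_or => /andP[za /IH {}IH].
rewrite !big_cons derivM derivXsubC mul1r hornerD !hornerM IH hornerXsubC.
rewrite mulrDr mulrAC divff ?mul1r ?mulrA// subr_eq0//.
Qed.

(** On the upper half plane |z - conj a| < |z - a| for each root a, so the two summands of g have
    different moduli and g has no zero there. As g is invariant under conjugation, all its zeros are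
    real. The number c + conj c is the leading coefficient, and its being nonzero keeps the degree
    of h. *)
Lemma hermite_biehler ps c (h := \prod_(a <- ps) ('X - a%:P))
    (g := real_part2 (c *: h)) :
  (forall a, a \in ps -> complex.Im a < 0) -> c + (c^*)%C != 0 ->
  exists rs : seq R[i], [/\ g = (c + (c^*)%C) *: \prod_(x <- rs) ('X - x%:P),
    uniq rs, size rs = size ps & forall x, x \in rs ->
      [/\ (x^*)%C = x, g.[x] = 0 & g^`().[x] != 0]].
Proof.
move=> psI cc.
have c0 : c != 0 by apply: contra_neq cc => ->; rewrite conjc0 addr0.
have hJ : map_poly (@conjc R) h = \prod_(a <- ps) ('X - ((a^*)%C)%:P).
  by rewrite /h map_prod_XsubC.
have gE : g = c *: h + (c^*)%C *: map_poly (@conjc R) h.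
  by rewrite /g /real_part2 linearZ.
(* The strict inequality between the products fails for the empty product, where g is a nonzero
   constant. *)
have [ps0|psN] := eqVneq (size ps) 0%N.
  exists [::]; split => //=.
  by rewrite gE hJ /h (size0nil ps0) !big_nil -scalerDl.
have {}psN : ps != [::] by case: (ps) psN.
have gJ : map_poly (@conjc R) g = g.
  rewrite /g /real_part2 rmorphD /= addrC; congr (_ + _).
  by rewrite -map_poly_comp /=; apply: map_poly_id => y _ /=; rewrite conjcK.
have hE z : h.[z] = \prod_(a <- ps) (z - a).
  by rewrite /h horner_prod; apply: eq_bigr => a _; rewrite hornerXsubC.
have gH z : 0 < complex.Im z -> g.[z] != 0.
  have cn : `|c| != 0 by rewrite normr_eq0.
  move=> z0; apply/eqP; rewrite gE hornerD !hornerZ => /eqP.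
  rewrite addr_eq0 => /eqP/(congr1 Num.norm).
  rewrite normrN !normrM normcJ => /(mulfI cn) hz.
  have := prod_normB_conj_lt psN z0 psI; rewrite -hE hz hJ horner_prod.
  under [in X in _ < X]eq_bigr do rewrite hornerXsubC.
  by rewrite ltxx.
have groot z : g.[z] = 0 -> (z^*)%C = z.
  move=> gz; have [z0|z0|] := ltrgt0P (complex.Im z).
  - by have := gH z z0; rewrite gz eqxx.
  - have : 0 < complex.Im (z^*)%C by case: (z) z0 => x y /=; rewrite oppr_gt0.
    by move=> /gH; rewrite -gJ horner_map /= gz conjc0 eqxx.
  - by case: (z) => x y /= ->; rewrite oppr0.
(* At a real zero, X = c h(z) is nonzero and purely imaginary, and g'(z) = X (s - conj s), where s =
   h'(z) / h(z) is a sum of numbers 1 / (z - a) with negative imaginary part. *)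
have simple z : g.[z] = 0 -> g^`().[z] != 0.
  move=> gz; have zr := groot z gz.
  have zps : z \notin ps.
    apply/negP => /psI; move: zr; case: (z) => x y [] /eqP.
    rewrite -subr_eq0 -opprD oppr_eq0 -mulr2n mulrn_eq0 /= => /eqP ->.
    by rewrite ltxx.
  have hz : h.[z] != 0 by rewrite -[_ == _]/(root h z) root_prod_XsubC.
  pose X := c * h.[z]; pose s := \sum_(a <- ps) (z - a)^-1.
  have XX : (X^*)%C = - X.
    apply/eqP; rewrite -addr_eq0 addrC -gz gE hornerD !hornerZ /X rmorphM /=.
    by rewrite -[in X in _ == _ + _ * X]zr horner_map.
  have -> : g^`().[z] = X * (s - (s^*)%C).
    rewrite gE derivD !derivZ hornerD !hornerZ deriv_map -[in X in _ + _ * X]zr.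
    rewrite horner_map /= /h deriv_prod_XsubC_horner// -/h -/s.
    have -> : (c^*)%C * ((h.[z] * s)^*)%C = (X^*)%C * (s^*)%C.
      by rewrite -!rmorphM /X mulrA.
    by rewrite XX mulNr mulrBr mulrA.
  rewrite mulf_neq0// ?mulf_neq0// subcJ !mulf_neq0//.
  - by rewrite pnatr_eq0.
  - rewrite fmorph_eq0; suff : complex.Im s < 0 by move=> /lt_eqF ->.
    rewrite /s raddf_sum /=.
    have zI : complex.Im z = 0.
      move: zr; case: (z) => x y [] /eqP.
      by rewrite -subr_eq0 -opprD oppr_eq0 -mulr2n mulrn_eq0 /= => /eqP.
    apply: (@lt_le_trans _ _ (\sum_(a <- ps | a \in ps) (0 : R))); last by rewrite big1.
    rewrite big_seq; apply: ltr_sum.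
      by case: (ps) psN => //= a l _; rewrite mem_head.
    move=> a /psI a0; apply: Im_inv_lt0.
    by rewrite raddfB /= zI sub0r oppr_gt0.
  - by rewrite eq_complex /= oner_eq0 andbF.
have gn : g`_(size ps) = c + (c^*)%C.
  have hn : h`_(size ps) = 1.
    by rewrite -[RHS](eqP (monic_prod_XsubC ps xpredT id)) lead_coefE size_prod_XsubC.
  by rewrite /g /real_part2 coefD coef_map coefZ hn mulr1.
have sg : size g = (size ps).+1.
  apply/eqP; rewrite eqn_leq; apply/andP; split; last first.
    by rewrite ltnNge; apply: contra cc => /(nth_default 0); rewrite gn => ->.
  rewrite gE (leq_trans (size_polyD _ _))// geq_max.
  by rewrite !(leq_trans (size_scale_leq _ _))// ?hJ size_prod_XsubC.
have lg : lead_coef g = c + (c^*)%C by rewrite lead_coefE sg gn.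
have [rs gP] := closed_field_poly_normal g; rewrite lg in gP.
have rsroot x : x \in rs -> g.[x] = 0.
  rewrite -root_prod_XsubC => /rootP rx.
  by rewrite gP hornerZ rx mulr0.
exists rs; split => //.
- rewrite -separable_prod_XsubC separable_poly.unlock.
  apply: Pdiv.ClosedField.root_coprimep => x; rewrite root_prod_XsubC => /rsroot/simple.
  by rewrite {1}gP derivZ hornerZ mulf_eq0 negb_or => /andP[].
- by have := sg; rewrite gP size_scale// size_prod_XsubC => -[].
- by move=> x /rsroot gx; split; [exact: groot|exact: gx|exact: simple].
Qed.

End HermiteBiehler.

(** * Division by linear factors *)

(** Polynomials over the ring of germs, presented fibrewise; the uniform bound n makes evaluation a
    fixed finite sum. *)
Definition polygerm (R : realType) (n : nat) (F : R[i] -> {poly R[i]}) :=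
  (forall z, (size (F z) <= n)%N) /\ forall j, germ (fun z => (F z)`_j).

Section Division.
Variable R : realType.
Implicit Types (F : R[i] -> {poly R[i]}) (y g : R[i] -> R[i]).

Lemma germ_const (c : R[i]) : germ (fun _ : R[i] => c).
Proof.
rewrite (_ : (fun _ => c) = fun z => (c%:P).[z]); first exact: germ_poly.
by apply/funext => z; rewrite hornerC.
Qed.

Lemma germX g k : germ g -> germ (fun z => g z ^+ k).
Proof.
move=> gg; elim: k => [|k IH]; first exact: germ_const.
by under eq_fun do rewrite exprS; exact: germM.
Qed.

Lemma germN g : germ g -> germ (fun z => - g z).
Proof.
move=> gg; under eq_fun do rewrite -mulN1r.
by apply: germM gg; exact: germ_const.
Qed.

Lemma polygerm_horner n F y : polygerm n F -> germ y -> germ (fun z => (F z).[y z]).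
Proof.
move=> [Fn Fg] yg.
rewrite (_ : (fun z => _) = fun z => \sum_(i < n) (F z)`_i * y z ^+ i); last first.
  by apply/funext => z; rewrite (horner_coef_wide _ (Fn z)).
apply: germ_sum => i _; apply: germM; first exact: Fg.
exact: germX.
Qed.

Lemma polygerm_divX n F y : polygerm n F -> germ y ->
  exists2 Q, polygerm n Q &
    forall z, F z = ('X - (y z)%:P) * Q z + ((F z).[y z])%:P.
Proof.
move=> [Fn Fg] yg.
(* From F(X) - F(y) = sum of F_k (X^k - y^k), with X - y taken out of each X^k - y^k. No division of
   germs occurs, so the coefficients are germs. *)
pose Q z := \sum_(k < n) (F z)`_k *: \sum_(i < k) 'X^(k.-1 - i) * (y z)%:P ^+ i.
exists Q.
  split.
    move=> z; apply: (leq_trans (size_sum _ _ _)); apply/bigmax_leqP => k _.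
    apply: (leq_trans (size_scale_leq _ _)); apply: (leq_trans (size_sum _ _ _)).
    apply/bigmax_leqP => i _; rewrite -polyC_exp mulrC mul_polyC.
    apply: (leq_trans (size_scale_leq _ _)); rewrite size_polyXn.
    rewrite (leq_trans _ (ltn_ord k))// ltnS (leq_trans (leq_subr _ _))//.
    exact: leq_pred.
  move=> j.
  rewrite (_ : (fun z => _) = fun z => \sum_(k < n) (F z)`_k *
      \sum_(i < k) (j == (k.-1 - i)%N)%:R * y z ^+ i); last first.
    apply/funext => z; rewrite coef_sum; apply: eq_bigr => k _.
    rewrite coefZ coef_sum; congr (_ * _); apply: eq_bigr => i _.
    by rewrite -polyC_exp coefMC coefXn.
  apply: germ_sum => k _; apply: germM; first exact: Fg.
  apply: germ_sum => i _; apply: germM; first exact: germ_const.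
  exact: germX.
move=> z; rewrite /Q mulr_sumr (horner_coef_wide _ (Fn z)).
rewrite rmorph_sum -big_split /= -[LHS]coefK.
rewrite poly_def (big_ord_widen _ (fun i => (F z)`_i *: 'X^i) (Fn z)) big_mkcond.
apply: eq_bigr => k _ /=; case: ltnP => [_|Fk]; last first.
  by rewrite nth_default// scale0r mul0r polyC0 mulr0 addr0.
rewrite -scalerAr -subrXX rmorphM rmorphXn /= mul_polyC -scalerDr.
by rewrite subrK.
Qed.

(** Induction on the roots. After division by one root, the quotient is seen to vanish at another
    only where the two differ, that is for z <> 0; [germ_eq0] extends this to z = 0, where roots may
    coincide. *)
Lemma polygerm_div (I : eqType) (s : seq I) (y : I -> R[i] -> R[i]) n F :
  polygerm n F -> uniq s -> (forall x, x \in s -> germ (y x)) ->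
  (forall x, x \in s -> \forall z \near (0 : R[i]^o), (F z).[y x z] = 0) ->
  (forall x x', x \in s -> x' \in s -> x != x' ->
    \forall z \near (0 : R[i]^o)^', y x z != y x' z) ->
  exists2 V, polygerm n V & \forall z \near (0 : R[i]^o),
    F z = V z * \prod_(x <- s) ('X - (y x z)%:P).
Proof.
elim: s => [|x s IH] in F *.
  move=> FV _ _ _ _; exists F; first exact: FV.
  by near=> z; rewrite big_nil mulr1.
move=> Fg /= /andP[xs us] yg yroot yneq.
have [Q Qg FQ] := polygerm_divX Fg (yg x (mem_head _ _)).
have Froot := yroot x (mem_head _ _).
have [|||V Vg QV] := IH Q Qg us.
- by move=> x' x's; apply: yg; rewrite inE x's orbT.
- move=> x' x's; have x'xs : x' \in x :: s by rewrite inE x's orbT.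
  have xx' : x' != x by apply: contraNneq xs => <-.
  apply: (germ_eq0 (polygerm_horner Qg (yg x' x'xs))).
  have Froot' := yroot x' x'xs.
  near=> z.
  have Fx : (F z).[y x z] = 0 by near: z; exact: nbhs_dnbhs.
  have Fx' : (F z).[y x' z] = 0 by near: z; exact: nbhs_dnbhs.
  have xx'z : y x' z != y x z.
    by near: z; apply: yneq => //; exact: mem_head.
  move/eqP: Fx'; rewrite FQ Fx addr0 hornerM hornerXsubC mulf_eq0 subr_eq0.
  by rewrite (negbTE xx'z) => /eqP.
- by move=> a b as_ bs; apply: yneq; rewrite inE ?as_ ?bs orbT.
exists V; first exact: Vg.
apply: filterS2 Froot QV => z Fz QVz.
by rewrite FQ Fz addr0 QVz big_cons mulrCA.
Unshelve. all: by end_near. Qed.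

Lemma polygerm_analytic2 n F : polygerm n F -> analytic2 (fun z1 z2 => (F z1).[z2]).
Proof.
move=> [Fn Fg].
(* A common radius and bound for the finitely many coefficients; r <= 1 allows the weight r^(i+j) to
   be bounded by r^i. *)
have [r [r0 [r1 [K [A AP]]]]] : exists r, 0 < r /\ r <= 1 /\
    exists K, exists A : nat -> nat -> {poly R[i]}, forall j, (j < n)%N -> germ_of (A j) (fun z => (F z)`_j) r /\
      forall N, wnorm r (A j N) <= K.
  elim: n {Fn} => [|n [r [r0 [r1 [K [A AP]]]]]].
    by exists 1; split => //; split => //; exists 0, (fun _ _ => 0).
  have [B [s Bg]] := Fg n.
  have [s0 _ _ _] := Bg.
  have [t [t0 tr ts]] := exists_gt0_le2 r0 s0.
  have Bt := germ_of_le Bg t0 ts.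
  have [_ [K' BK] _ _] := Bt.
  have K'0 : 0 <= K' by apply: le_trans (BK 0%N); exact: wnorm_ge0 (ltW t0) _.
  exists t; split => //; split; first exact: le_trans r1.
  exists (`|K| + K'), (fun j => if (j < n)%N then A j else B) => j.
  rewrite ltnS leq_eqVlt => /predU1P[->|jn].
    rewrite ltnn; split => // N; rewrite (le_trans (BK N))// lerDr//.
  rewrite jn; have [Ag AK] := AP j jn; split; first exact: germ_of_le Ag t0 tr.
  move=> N; rewrite (le_trans (le_wnorm (ltW r0) _ tr (ltW t0)))//.
  have K0 : 0 <= K by apply: le_trans (AK 0%N); exact: wnorm_ge0 (ltW r0) _.
  by rewrite (le_trans (AK N))// ger0_norm// lerDl.
pose a i j := if (j < n)%N then (A j i.+1)`_i else 0.
exists a; split.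
  exists r, `|K|; split => // i j; rewrite /a; case: ifP => [jn|_]; last first.
    by rewrite normr0 mul0r.
  have [Ag AK] := AP j jn.
  have K0 : 0 <= K by apply: le_trans (AK 0%N); exact: wnorm_ge0 (ltW r0) _.
  rewrite (ger0_norm K0) (le_trans _ (AK i.+1))//.
  apply: (@le_trans _ _ (`|(A j i.+1)`_i| * r ^+ i)).
    apply: ler_wpM2l => //; rewrite exprD; apply: ler_piMr.
      by rewrite exprn_ge0// ltW.
    by rewrite exprn_ile1// ltW.
  rewrite (wnorm_wide r (leq_maxl _ i.+1)).
  have iM : (i < maxn (size (A j i.+1)) i.+1)%N by rewrite leq_max ltnSn orbT.
  rewrite (bigD1 (Ordinal iM))//= lerDl sumr_ge0// => k _.
  by rewrite mulr_ge0// exprn_ge0// ltW.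
exists ([set z | `|z| <= r / 2], setT) => /=.
  split; last exact: filterT.
  by apply: (@nbhs0_le _ R[i]^o); rewrite divr_gt0.
move=> [z1 z2] /= [z1r _].
rewrite (horner_coef_wide _ (Fn z1)).
have lim : (fun N => \sum_(j < n) series (fun i => (A j i.+1)`_i * z1 ^+ i) N * z2 ^+ j)
    @ \oo --> (\sum_(j < n) (F z1)`_j * z2 ^+ j : R[i]^o).
  apply: (@cvg_big R[i]^o 'I_n +%R 0 xpredT); first exact: add_continuous.
  move=> j _; apply: cvgMr_tmp; have [Ag _] := AP j (ltn_ord j).
  exact: germ_of_series Ag z1r.
apply: cvg_trans lim; apply: near_eq_cvg; near=> N.
have nN : (n <= N)%N by near: N; exact: nbhs_infty_ge.
rewrite exchange_big /= (big_ord_widen _ (fun j =>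
  series (fun i => (A j i.+1)`_i * z1 ^+ i) N * z2 ^+ j) nN).
rewrite big_mkcond; apply: eq_bigr => j _; case: ltnP => jn.
  by rewrite /series/= big_mkord mulr_suml; apply: eq_bigr => i _; rewrite /a jn.
by rewrite big1// => i _; rewrite /a ltnNge jn /= !mul0r.
Unshelve. all: by end_near. Qed.

End Division.

(** * The pencil A + t B *)

Section Pencil.
Variable R : realType.
Implicit Types (p : {poly {poly R[i]}}) (t : R).

Definition pencil_coef t : R[i] := (2^-1 -i* (t / 2))%C.

Definition pencil p t : {poly {poly R[i]}} :=
  (pencil_coef t)%:P *: p + ((pencil_coef t)^*%C)%:P *: conj_poly p.

Lemma pencil_coefE t :
  pencil_coef t = 2^-1 + t%:C%C * (2 * 'i%C)^-1 /\
  (pencil_coef t)^*%C = 2^-1 - t%:C%C * (2 * 'i%C)^-1.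
Proof.
have i2 : (2 * 'i%C)^-1 = (0 -i* 2^-1)%C :> R[i].
  have n2 : (2 : R[i]) = (2 +i* 0)%C by rewrite -[LHS](rmorph_nat (real_complex R)).
  have i20 : 2 * 'i%C != 0 :> R[i].
    by rewrite mulf_neq0 ?pnatr_eq0// eq_complex /= oner_eq0 andbF.
  apply: (mulfI i20); rewrite divff// n2; simpc.
  by rewrite divff ?pnatr_eq0.
have h2 : 2^-1 = (2^-1 +i* 0)%C :> R[i].
  by rewrite -(rmorph_nat (real_complex R)) -fmorphV.
by split; rewrite /pencil_coef i2 h2; simpc; rewrite /= ?opprK.
Qed.

Lemma horner_pencil p t (z1 z2 : R[i]) :
  (pencil p t).[z1, z2] =
  (polyA p).[z1, z2] + t%:C%C * (polyB p).[z1, z2].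
Proof.
have [cE cJE] := pencil_coefE t.
by rewrite /pencil cJE cE /polyA /polyB !hornerE /=; ring.
Qed.

(** Subtracting the two equations leaves a nonzero multiple of (s - t)(x - y), so x = y; then c +
    conj c = 1 gives x = 0. *)
Lemma pencil_coef_inj (s t : R) (x y : R[i]) : s != t ->
  pencil_coef s * x + (pencil_coef s)^*%C * y = 0 ->
  pencil_coef t * x + (pencil_coef t)^*%C * y = 0 -> x = 0 /\ y = 0.
Proof.
have [-> ->] := pencil_coefE s; have [-> ->] := pencil_coefE t.
set k := (2 * 'i%C)^-1 => st xs xt.
have k0 : k != 0.
  by rewrite invr_eq0 mulf_neq0 ?pnatr_eq0// eq_complex /= oner_eq0 andbF.
have st0 : s%:C%C - t%:C%C != 0 :> R[i] by rewrite subr_eq0 (inj_eq (@complexI R)).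
have xy : x = y.
  apply/eqP; rewrite -subr_eq0; apply/eqP/(mulfI k0)/(mulfI st0).
  by rewrite !mulr0 -[RHS](subrr 0) -{1}xs -{1}xt; ring.
have half : 2^-1 + 2^-1 = 1 :> R[i] by rewrite [RHS]splitr mul1r.
have y0 : y = 0 by move: xs; rewrite xy -mulrDl addrACA subrr addr0 half mul1r.
by rewrite xy y0.
Qed.

Lemma conj_pencil p t : conj_poly (pencil p t) = pencil p t.
Proof.
have conjK : conj_poly (conj_poly p) = p.
  rewrite /conj_poly -map_poly_comp; apply: map_poly_id => a _ /=.
  by rewrite -map_poly_comp; apply: map_poly_id => b _ /=; rewrite conjcK.
rewrite /pencil; move: (pencil_coef t) => c.
rewrite {1}/conj_poly rmorphD /= !map_polyZ /= !map_polyC /= conjcK.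
by rewrite -!/(conj_poly _) conjK addrC.
Qed.

(** The expression is Re x + t Im x, a nonzero affine function of t, with at most one zero. *)
Lemma finite_pencil_coef (x : R[i]) : x != 0 ->
  for_almost_all (fun t => pencil_coef t * x + (pencil_coef t * x)^*%C != 0).
Proof.
move=> x0; have eqv t : pencil_coef t * x + (pencil_coef t * x)^*%C =
    (complex.Re x + t * complex.Im x)%:C%C.
  rewrite /pencil_coef; case: (x) => a b; simpc; congr (_ +i* _)%C.
  by rewrite /=; field.
have [Ix|Ix] := eqVneq (complex.Im x) 0.
  apply: sub_finite_set (finite_set0 R) => t /=; apply: contra_notP => _.
  rewrite eqv Ix mulr0 addr0 fmorph_eq0.
  by apply: contra x0 => /eqP Rx; rewrite eq_complex Rx Ix /= eqxx.
apply: sub_finite_set (finite_set1 (- complex.Re x / complex.Im x)) => t /=.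
move=> /negP; rewrite negbK eqv fmorph_eq0 addrC addr_eq0 => /eqP <-.
by rewrite mulfK.
Qed.

Lemma for_almost_all_sub (P Q : R -> Prop) : (forall t, P t -> Q t) ->
  for_almost_all P -> for_almost_all Q.
Proof. by move=> PQ; apply: sub_finite_set => t /= nQ /PQ. Qed.

Lemma for_almost_all_and (P Q : R -> Prop) : for_almost_all P -> for_almost_all Q ->
  for_almost_all (fun t => P t /\ Q t).
Proof.
move=> fP fQ; apply: (@sub_finite_set _ _ ([set t | ~ P t] `|` [set t | ~ Q t])).
  by move=> t /= /not_andP.
by rewrite finite_setU.
Qed.

Lemma for_almost_all_forall (I : finType) (P : I -> R -> Prop) :
  (forall i, for_almost_all (P i)) -> for_almost_all (fun t => forall i, P i t).
Proof.
move=> fP; have : finite_set (\bigcup_(i in [set: I]) [set t | ~ P i t]).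
  by apply: bigcup_finite => // i _; exact: fP.
apply: sub_finite_set => t /= /existsNP[i nP]; by exists i.
Qed.

Lemma for_almost_all_two (P : R -> Prop) : for_almost_all P ->
  exists s t, [/\ s != t, P s & P t].
Proof.
move=> fP.
have inj : {in ((fun n : nat => n%:R) @^-1` [set t | ~ P t]) &,
    injective (fun n : nat => n%:R : R)} by move=> m n _ _ /eqP; rewrite eqr_nat => /eqP.
have fN := finite_preimage inj fP.
have [m [_ /= /contrapT Pm]] := infinite_setN0 (infinite_setD infinite_nat fN).
have fNm : finite_set (((fun n : nat => n%:R : R) @^-1` [set t | ~ P t]) `|` [set m]).
  by rewrite finite_setU; split => //; exact: finite_set1.
have [n [_ /= nPn]] := infinite_setN0 (infinite_setD infinite_nat fNm).
exists m%:R, n%:R; split => //.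
  by rewrite eqr_nat; apply/eqP => mn; apply: nPn; right.
by apply: contrapT => nP; apply: nPn; left.
Qed.

End Pencil.

(** * The substitution z2 = - Q(z1) + z1^(2 l) w *)

Section Nodes.
Variable R : realType.
Implicit Types (Q : {poly R}) (l : nat) (v w z : R[i]).

Definition node Q l w z : R[i] := - (complex_poly Q).[z] + z ^+ (2 * l) * w.

(* [contact Q l Q' l'] is the order of vanishing of [Q' - Q], capped at 2 l and 2 l';
   it is the power of z1 to divide by in a factor with data (Q', l') after the
   substitution z2 = node Q l w z1. *)
Definition contact Q l Q' l' : nat :=
  find (fun i => (Q' - Q)`_i != 0) (iota 0 (minn (2 * l) (2 * l'))).

(* The limit, as a polynomial in w, of that factor. *)
Definition initial Q l Q' l' v : {poly R[i]} :=
  ((2 * l == contact Q l Q' l')%N)%:R *: 'X +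
  ((((Q' - Q)`_(contact Q l Q' l'))%:C)%C +
     ((2 * l' == contact Q l Q' l')%N)%:R * v)%:P.

Lemma contact_le Q l Q' l' : (contact Q l Q' l' <= minn (2 * l) (2 * l'))%N.
Proof. by rewrite -[leqRHS](size_iota 0) find_size. Qed.

Lemma coef_lt_contact Q l Q' l' i : (i < contact Q l Q' l')%N -> (Q' - Q)`_i = 0.
Proof.
move=> ic; have := before_find 0%N ic.
by rewrite nth_iota ?add0n 1?(leq_trans ic (contact_le _ _ _ _))// => /negbFE/eqP.
Qed.

Lemma coef_contact_neq0 Q l Q' l' : (contact Q l Q' l' < minn (2 * l) (2 * l'))%N ->
  (Q' - Q)`_(contact Q l Q' l') != 0.
Proof.
move=> cl; have hc : has (fun i => (Q' - Q)`_i != 0) (iota 0 (minn (2 * l) (2 * l'))).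
  by rewrite has_find size_iota.
by have := nth_find 0%N hc; rewrite nth_iota// add0n.
Qed.

Lemma coef_complex_polyB Q Q' i :
  (complex_poly Q' - complex_poly Q)`_i = (((Q' - Q)`_i)%:C)%C.
Proof. by rewrite -rmorphB coef_map. Qed.

(** The factor becomes z^(2 l) w + (Q' - Q)(z) + z^(2 l') v. No exponent is below the contact order,
    and only terms of exactly that order survive in the limit. *)
Lemma cvg_factor_node Q l Q' l' (w v : R[i] -> R[i]^o) (w0 v0 : R[i]^o) :
  w @ (0 : R[i]^o)^' --> w0 -> v @ (0 : R[i]^o)^' --> v0 ->
  (fun z : R[i]^o => Defs.factor (complex_poly Q') l' (v z) z (node Q l (w z) z) /
     z ^+ contact Q l Q' l' : R[i]^o)
    @ (0 : R[i]^o)^' --> ((initial Q l Q' l' v0).[w0] : R[i]^o).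
Proof.
move=> ww vv.
have := contact_le Q l Q' l'; rewrite leq_min => /andP[cl cl'].
have d0 i : (i < contact Q l Q' l')%N -> (complex_poly Q' - complex_poly Q)`_i = 0.
  by move=> ic; rewrite coef_complex_polyB (coef_lt_contact ic) rmorph0.
have lim := cvg_factor_div cl cl' d0 ww vv.
rewrite coef_complex_polyB in lim.
rewrite /initial hornerD hornerZ hornerX hornerC addrA.
apply: cvg_trans lim; apply: near_eq_cvg; apply: nearW => z /=.
by rewrite /Defs.factor /node hornerD hornerN; congr (_ / _); ring.
Qed.

Lemma node_cvg0 Q l (w : R[i] -> R[i]^o) (w0 : R[i]^o) : (0 < l)%N -> Q.[0] = 0 ->
  w @ (0 : R[i]^o)^' --> w0 ->
  (fun z : R[i]^o => node Q l (w z) z : R[i]^o) @ (0 : R[i]^o)^' --> (0 : R[i]^o).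
Proof.
move=> l0 Q0 ww.
have Q0' : (complex_poly Q).[0] = 0.
  by rewrite -[X in _.[X]](rmorph0 (real_complex R)) horner_map Q0 rmorph0.
have val0 : - (complex_poly Q).[0] + ('X^(2 * l)).[0] * w0 = 0.
  by rewrite Q0' hornerXn expr0n muln_eq0 /= eqn0Ngt l0 /= mul0r addr0 oppr0.
have lQ := @cvg_horner R _ _ (dnbhs_filter _) (complex_poly Q) _ _ (@cvg_id_dnbhs R).
have lX := @cvg_horner R _ _ (dnbhs_filter _) 'X^(2 * l) _ _ (@cvg_id_dnbhs R).
have := @cvgD _ R[i]^o _ _ (dnbhs_filter _) _ _ _ _
  (@cvgN _ R[i]^o _ _ (dnbhs_filter _) _ _ lQ)
  (@cvgM _ _ _ (dnbhs_filter _) _ _ _ _ lX ww).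
rewrite val0; apply: cvg_trans; apply: near_eq_cvg; apply: nearW => z /=.
by rewrite /node fctE /= hornerXn.
Qed.

Lemma conj_complex_poly Q : map_poly (@conjc R) (complex_poly Q) = complex_poly Q.
Proof. by apply/polyP => i; rewrite !coef_map /= oppr0. Qed.

Lemma node_conj Q l w z : ((node Q l w z)^*)%C = node Q l (w^*)%C (z^*)%C.
Proof.
by rewrite /node rmorphD rmorphN rmorphM rmorphXn /= -horner_map /= conj_complex_poly.
Qed.

(** The segment Q' continues Q past order 2 l; such a branch has the limit w + r with r real,
    whatever its v. *)
Definition deeper Q l Q' l' := (2 * l < 2 * l')%N && (contact Q l Q' l' == 2 * l)%N.

Lemma contact_same Q l : contact Q l Q l = (2 * l)%N.
Proof.
have := contact_le Q l Q l; rewrite minnn => cl.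
apply/eqP; rewrite eqn_leq cl leqNgt /=.
apply/negP => c; have := @coef_contact_neq0 Q l Q l.
by rewrite minnn subrr coef0 eqxx => /(_ c).
Qed.

Lemma initial_same Q l v : initial Q l Q l v = 'X + v%:P.
Proof.
by rewrite /initial contact_same eqxx subrr coef0 scale1r mul1r rmorph0 add0r.
Qed.

Lemma initial_deeper Q l Q' l' v : deeper Q l Q' l' ->
  initial Q l Q' l' v = 'X + ((((Q' - Q)`_(2 * l))%:C)%C)%:P.
Proof.
move=> /andP[ll' /eqP c]; rewrite /initial c eqxx scale1r.
by rewrite gtn_eqF// mul0r addr0.
Qed.

(** If the contact were 2 l, not being deeper would force l' = l, and Q' - Q, of degree below 2 l
    and vanishing to that order, would be 0. *)
Lemma contact_lt Q l Q' l' : (size Q <= 2 * l)%N -> (size Q' <= 2 * l')%N ->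
  (Q', l') != (Q, l) -> ~~ deeper Q l Q' l' -> (contact Q l Q' l' < 2 * l)%N.
Proof.
move=> sQ sQ' ne nd; have := contact_le Q l Q' l'; rewrite leq_min => /andP[cl cl'].
rewrite ltn_neqAle cl andbT; apply/eqP => ce.
move: nd; rewrite /deeper ce eqxx andbT -leqNgt => l'l.
have ll' : l' = l by apply/eqP; rewrite -(eqn_pmul2l (isT : 0 < 2)%N) eqn_leq l'l -ce cl'.
move: ne; rewrite ll' xpair_eqE eqxx andbT => /eqP; apply.
apply/eqP; rewrite -subr_eq0; apply/eqP/polyP => i; rewrite coef0.
have [ic|ci] := ltnP i (contact Q l Q' l'); first exact: coef_lt_contact ic.
rewrite nth_default// (leq_trans (size_polyD _ _))// size_polyN geq_max.
by rewrite -ll' in sQ *; rewrite !(leq_trans _ ci)// ce ?ll'// -ll'.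
Qed.

Lemma initial_lt Q l Q' l' v : (contact Q l Q' l' < 2 * l)%N ->
  initial Q l Q' l' v = ((((Q' - Q)`_(contact Q l Q' l'))%:C)%C +
     ((2 * l' == contact Q l Q' l')%N)%:R * v)%:P.
Proof. by move=> c; rewrite /initial gtn_eqF// scale0r add0r. Qed.

(** If the contact is 2 l', the imaginary part of v prevents cancellation; otherwise the real
    coefficient at the contact order is nonzero. The alternative 2 l <= 2 l' rules out the first
    case and serves when nothing is known about the sign of Im v. *)
Lemma initial_lt_neq0 Q l Q' l' v : (contact Q l Q' l' < 2 * l)%N ->
  (2 * l <= 2 * l')%N \/ 0 < complex.Im v ->
  (((Q' - Q)`_(contact Q l Q' l'))%:C)%C +
     ((2 * l' == contact Q l Q' l')%N)%:R * v != 0.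
Proof.
move=> cl; have [c|c h] := eqVneq (2 * l')%N (contact Q l Q' l').
  case=> [|v0]; first by rewrite c leqNgt cl.
  rewrite mul1r; apply: contraTneq v0 => /(congr1 (@complex.Im R)).
  by rewrite raddfD /= add0r => ->; rewrite ltxx.
rewrite mul0r addr0 fmorph_eq0 coef_contact_neq0// ltn_neqAle contact_le andbT.
by rewrite minnE; apply: contraNneq c; lia.
Qed.

End Nodes.

Lemma poly_ext (K : numDomainType) (p p' : {poly K}) :
  (forall x, p.[x] = p'.[x]) -> p = p'.
Proof.
move=> pp'; apply/eqP; rewrite -subr_eq0; apply/eqP.
apply: (@roots_geq_poly_eq0 _ _ [seq n%:R | n <- iota 0 (size (p - p'))]).
- by apply/allP => x _; rewrite rootE hornerD hornerN pp' subrr.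
- by rewrite map_inj_uniq ?iota_uniq// => m n /eqP; rewrite eqr_nat => /eqP.
- by rewrite size_map size_iota.
Qed.

(** * Limits of products and of the pencil along nodes *)

Section NodeLimits.
Variable R : realType.
Implicit Types (Q : {poly R}) (l : nat) (w z : R[i]).

Lemma cvg_cst_dnbhs0 w : (fun _ : R[i]^o => w : R[i]^o) @ (0 : R[i]^o)^' --> (w : R[i]^o).
Proof. exact: (@cvg_cst R[i]^o). Qed.

Lemma cvg_node_product (I : finType) Q l w (f u : R[i] -> R[i] -> R[i])
    (F : I -> R[i] -> R[i] -> R[i]) (e : I -> nat) (li : I -> {poly R[i]}) :
  (0 < l)%N -> Q.[0] = 0 -> analytic2 u ->
  (\near0 z1 z2, f z1 z2 = u z1 z2 * \prod_x F x z1 z2) ->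
  (forall x, (fun z : R[i]^o => F x z (node Q l w z) / z ^+ e x : R[i]^o)
     @ (0 : R[i]^o)^' --> ((li x).[w] : R[i]^o)) ->
  (fun z : R[i]^o => f z (node Q l w z) / z ^+ (\sum_x e x) : R[i]^o)
     @ (0 : R[i]^o)^' --> ((u 0 0 *: \prod_x li x).[w] : R[i]^o).
Proof.
move=> l0 Q0 ua fF Fl.
have n0 := node_cvg0 l0 Q0 (@cvg_cst_dnbhs0 w).
have fE := @near0_comp _ _ _ _ (dnbhs_filter _) _ _ fF (@cvg_id_dnbhs R) n0.
have u0 := @analytic2_cvg _ _ _ _ (dnbhs_filter _) _ _ ua (@cvg_id_dnbhs R) n0.
have Fp := @cvg_bigprod R _ _ (dnbhs_filter _) _ (index_enum I) xpredT _ _ (fun x _ => Fl x).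
rewrite hornerZ horner_prod.
have := @cvgM _ _ _ (dnbhs_filter _) _ _ _ _ u0 Fp.
apply: cvg_trans; apply: near_eq_cvg; apply: filterS fE => z /= ->.
by rewrite -mulrA -prodrXr -prodf_div.
Qed.

Lemma cvg_conj (T : Type) (F : set_system T) {FF : Filter F} (f : T -> R[i]^o)
    (a : R[i]^o) : f @ F --> a -> (fun x => ((f x)^*)%C : R[i]^o) @ F --> ((a^*)%C : R[i]^o).
Proof.
move=> /cvgrPdist_le fa; apply/cvgrPdist_le => e /fa; apply: filterS => x.
by rewrite -rmorphB /= normcJ.
Qed.

Lemma cvg_conj_dnbhs :
  (fun z : R[i]^o => (z^*)%C : R[i]^o) @ (0 : R[i]^o)^' --> (0 : R[i]^o)^'.
Proof.
move=> A /nbhs_norm0P[e /= e0 eA].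
suff : \forall z \near (0 : R[i]^o), z != 0 -> A (z^*)%C by [].
apply/nbhs_norm0P; exists e => //= z ze z0.
apply: eA => /=; first by rewrite normcJ.
by rewrite conjc_eq0.
Qed.

Lemma horner_real_part2 (p : {poly R[i]}) w :
  (real_part2 p).[w] = p.[w] + ((p.[(w^*)%C])^*)%C.
Proof. by rewrite /real_part2 hornerD -[w in X in _ + X]conjcK horner_map. Qed.

(** As Q is real, conjugating a node conjugates w and z, so the conjugate polynomial contributes the
    conjugate of the limit for p at conj w. *)
Lemma cvg_pencil (p : {poly {poly R[i]}}) Q l s (P0 : {poly R[i]}) t w :
  (forall w, (fun z : R[i]^o => p.[z, node Q l w z] / z ^+ s : R[i]^o)
     @ (0 : R[i]^o)^' --> (P0.[w] : R[i]^o)) ->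
  (fun z : R[i]^o => (pencil p t).[z, node Q l w z] / z ^+ s : R[i]^o)
     @ (0 : R[i]^o)^' --> ((real_part2 (pencil_coef t *: P0)).[w] : R[i]^o).
Proof.
move=> pP; rewrite /pencil; move: (pencil_coef t) => c.
have cP : (fun z : R[i]^o => (conj_poly p).[z, node Q l w z] / z ^+ s : R[i]^o)
     @ (0 : R[i]^o)^' --> (((P0.[(w^*)%C])^*)%C : R[i]^o).
  have := @cvg_conj _ _ (dnbhs_filter _) _ _ (cvg_comp _ _ cvg_conj_dnbhs (pP (w^*)%C)).
  apply: cvg_trans; apply: near_eq_cvg; apply: nearW => z /=.
  by rewrite conj_polyE node_conj rmorphM fmorphV rmorphXn /= conjcK.
rewrite horner_real_part2 hornerZ hornerZ rmorphM.
have := @cvgD _ R[i]^o _ _ (dnbhs_filter _) _ _ _ _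
  (@cvgMl_tmp _ _ _ (dnbhs_filter _) _ (c : R[i]^o) _ (pP w))
  (@cvgMl_tmp _ _ _ (dnbhs_filter _) _ (c^*%C : R[i]^o) _ cP).
apply: cvg_trans; apply: near_eq_cvg; apply: nearW => z /=.
by rewrite !hornerE mulrDl -!mulrA.
Qed.

Lemma conj_swapXY (f : {poly {poly R[i]}}) : conj_poly (swapXY f) = swapXY (conj_poly f).
Proof.
apply/polyP => i; apply/polyP => j.
by rewrite /conj_poly !coef_map !coef_swapXY !coef_map.
Qed.

(** Along the node, f is a polynomial in z with coefficients polynomial in w. A finite limit after
    division by z^s annihilates the coefficients of index below s at every w, hence identically. *)
Lemma node_polynomial (f : {poly {poly R[i]}}) Q l s (P : {poly R[i]}) :
  conj_poly f = f ->
  (forall w, (fun z : R[i]^o => f.[z, node Q l w z] / z ^+ s : R[i]^o)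
     @ (0 : R[i]^o)^' --> (P.[w] : R[i]^o)) ->
  exists G : {poly {poly R[i]}}, [/\ conj_poly G = G,
    forall z w, f.[z, node Q l w z] = z ^+ s * G.[w, z],
    forall w, G.[w, 0] = P.[w] & forall w, G^`().[w, 0] = P^`().[w]].
Proof.
move=> freal fP.
(* The outer variable of [S] is w and the inner one z; [T] exchanges them, so that division by z^s
   drops coefficients. *)
pose S : {poly {poly R[i]}} :=
  swapXY f \Po ((- complex_poly Q)%:P + ('X^(2 * l))%:P * 'X).
have SE w z : S.[w, z] = f.[z, node Q l w z].
  rewrite /S horner_comp horner2_horner horner2_swapXY; congr (_.[_, _]).
  by rewrite /node !hornerE.
have cS : conj_poly S = S.
  rewrite /S [LHS]map_comp_poly -[map_poly _ (swapXY f)]/(conj_poly (swapXY f)).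
  rewrite conj_swapXY freal.
  rewrite rmorphD rmorphM /= !map_polyC /= map_polyX rmorphN /= conj_complex_poly.
  by rewrite map_polyXn.
pose T := swapXY S.
have TE w : (fun z : R[i]^o => (map_poly (horner_eval w) T).[z] / z ^+ s : R[i]^o)
    @ (0 : R[i]^o)^' --> (P.[w] : R[i]^o).
  apply: cvg_trans (fP w); apply: near_eq_cvg; apply: nearW => z /=.
  by rewrite -horner2_map_poly horner2_swapXY SE.
have Tlow i : (i < s)%N -> T`_i = 0.
  move=> si; apply: poly_ext => w; rewrite horner0.
  have [/(_ i si) + _] := coef_cvg_div (TE w).
  by rewrite coef_map.
have Ts : T`_s = P.
  apply: poly_ext => w; have [_ +] := coef_cvg_div (TE w).
  by rewrite coef_map.
pose D := drop_poly s T.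
have TD : T = D * 'X^s.
  rewrite -[LHS](poly_take_drop s) (_ : take_poly s T = 0) ?add0r//.
  by apply/polyP => i; rewrite coef_take_poly coef0; case: ifP => // /Tlow.
have G0 w : (swapXY D).[w, 0] = P.[w].
  by rewrite horner2_swapXY polyC0 horner_coef0 coef_drop_poly Ts.
exists (swapXY D); split => //.
- rewrite conj_swapXY; congr swapXY; apply/polyP => i.
  rewrite /conj_poly coef_map !coef_drop_poly -coef_map -/(conj_poly T).
  by rewrite /T conj_swapXY cS.
- move=> z w; rewrite -SE -horner2_swapXY -/T TD horner2_swapXY.
  by rewrite hornerM hornerXn hornerM -polyC_exp hornerC mulrC.
- move=> w; rewrite horner2_map_poly -deriv_map; congr (_^`().[_]).
  by apply: poly_ext => x; rewrite -horner2_map_poly.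
Qed.

End NodeLimits.

(** * Roots of the initial forms *)

Section Splitting.
Variables (R : realType) (I : finType) (q : I -> {poly R}) (L : I -> nat).
Hypothesis size_q : forall x, (size (q x) <= 2 * L x)%N.
Implicit Types (Q : {poly R}) (l : nat) (v : I -> R[i]) (x y : I).

Definition same Q l : pred I := [pred y | (q y, L y) == (Q, l)].
Definition deep Q l : pred I := [pred y | deeper Q l (q y) (L y)].

Definition deep_coef Q l y : R[i] := (((q y - Q)`_(2 * l))%:C)%C.

Definition deep_prod Q l : {poly R[i]} := \prod_(y | deep Q l y) ('X + (deep_coef Q l y)%:P).

Definition same_roots Q l v : seq R[i] := [seq - v y | y <- enum (same Q l)].

Definition scalar_prod Q l v : R[i] := \prod_(y | ~~ deep Q l y && ~~ same Q l y)
  ((((q y - Q)`_(contact Q l (q y) (L y)))%:C)%C +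
     ((2 * L y == contact Q l (q y) (L y))%N)%:R * v y).

Lemma same_not_deep Q l y : same Q l y -> ~~ deep Q l y.
Proof. by move=> /eqP[_ lE]; rewrite /deep /= /deeper lE ltnn. Qed.

Lemma contact_not_deep x y : ~~ deep (q x) (L x) y -> ~~ same (q x) (L x) y ->
  (contact (q x) (L x) (q y) (L y) < 2 * L x)%N.
Proof. by move=> /= nd ns; exact: contact_lt. Qed.

(** Branches deeper than x give linear factors with real roots, those with the data of x give w + v,
    and all others give constants because their contact is below 2 [L x]. *)
Lemma prod_initial x v :
  \prod_y initial (q x) (L x) (q y) (L y) (v y) =
  deep_prod (q x) (L x) * (scalar_prod (q x) (L x) v *:
    \prod_(a <- same_roots (q x) (L x) v) ('X - a%:P)).
Proof.
rewrite (bigID (deep (q x) (L x))) /=; congr (_ * _).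
  by apply: eq_bigr => y; exact: initial_deeper.
rewrite (bigID (same (q x) (L x))) /= mulrC -mul_polyC; congr (_ * _).
  rewrite /scalar_prod rmorph_prod; apply: eq_bigr => y /andP[nd ns].
  by rewrite initial_lt// contact_not_deep.
rewrite big_map big_enum /=; apply: eq_big => y.
  by apply/andP/idP => [[]//|sy]; split => //; exact: same_not_deep.
by move=> /andP[_ /eqP[-> ->]]; rewrite initial_same rmorphN opprK.
Qed.

Lemma conj_deep_prod Q l : map_poly (@conjc R) (deep_prod Q l) = deep_prod Q l.
Proof.
rewrite /deep_prod rmorph_prod; apply: eq_bigr => y _ /=.
by rewrite rmorphD /= map_polyX map_polyC /= oppr0.
Qed.

Lemma deep_prod_neq0 Q l : deep_prod Q l != 0.
Proof.
apply/prodf_neq0 => y _; rewrite -[(deep_coef Q l y)%:P]opprK -rmorphN.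
by rewrite polyXsubC_eq0.
Qed.

Lemma real_part2_initial (c d : R[i]) x v :
  real_part2 (c *: (d *: \prod_y initial (q x) (L x) (q y) (L y) (v y))) =
  deep_prod (q x) (L x) * real_part2 ((c * (d * scalar_prod (q x) (L x) v)) *:
    \prod_(a <- same_roots (q x) (L x) v) ('X - a%:P)).
Proof.
by rewrite prod_initial -!scalerAr !scalerA -mulrA scalerAr /real_part2 rmorphM /=
  conj_deep_prod mulrDr.
Qed.

Lemma scalar_prod_neq0 x v : (forall y, 0 < complex.Im (v y)) ->
  scalar_prod (q x) (L x) v != 0.
Proof.
move=> v0; apply/prodf_neq0 => y /andP[nd ns].
by apply: initial_lt_neq0; [exact: contact_not_deep | right].
Qed.

Lemma same_roots_Im Q l v a : (forall y, 0 < complex.Im (v y)) ->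
  a \in same_roots Q l v -> complex.Im a < 0.
Proof. by move=> v0 /mapP[y _ ->]; rewrite raddfN /= oppr_lt0. Qed.

(** The first condition preserves the degree; the second keeps the zeros of the Hermite-Biehler
    factor away from those of [deep_prod], so that they stay simple in the product. *)
Definition generic_coef (c : R[i]) x v (f : {poly R[i]} :=
    real_part2 (c *: \prod_(a <- same_roots (q x) (L x) v) ('X - a%:P))) :=
  c + (c^*)%C != 0 /\ forall y, deep (q x) (L x) y -> f.[- deep_coef (q x) (L x) y] != 0.

(** Every condition says that c b + conj (c b) <> 0 for a fixed b <> 0, c being the coefficient of
    the pencil. In the second, b involves the product over [same_roots] at a real point, nonzero
    since these roots are not real. *)
Lemma generic_pencil_coef (d : R[i]) v : d != 0 -> (forall y, 0 < complex.Im (v y)) ->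
  for_almost_all (fun t => forall x,
    generic_coef (pencil_coef t * (d * scalar_prod (q x) (L x) v)) x v).
Proof.
move=> d0 v0; apply: for_almost_all_forall => x.
have k0 : d * scalar_prod (q x) (L x) v != 0 by rewrite mulf_neq0// scalar_prod_neq0.
apply: for_almost_all_and; first exact: finite_pencil_coef.
apply: for_almost_all_forall => y.
set r := - deep_coef (q x) (L x) y.
have rJ : (r^*)%C = r by rewrite /r /deep_coef rmorphN /= oppr0.
pose h := \prod_(a <- same_roots (q x) (L x) v) ('X - a%:P).
have hr : h.[r] != 0.
  rewrite -[_ == _]/(root h r) root_prod_XsubC; apply/negP => /(same_roots_Im v0).
  by rewrite /r /deep_coef raddfN /= oppr0 ltxx.
apply: for_almost_all_sub (finite_pencil_coef (mulf_neq0 k0 hr)) => t + _.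
by rewrite horner_real_part2 rJ hornerZ !mulrA.
Qed.

Lemma exists_node_roots (c : I -> R[i]) v : (forall y, 0 < complex.Im (v y)) ->
  (forall x y, (q x, L x) = (q y, L y) -> c x = c y) ->
  (forall x, generic_coef (c x) x v) ->
  exists w : I -> R[i], [/\ forall x, ((w x)^*)%C = w x,
    forall x (P := deep_prod (q x) (L x) * real_part2 (c x *:
       \prod_(a <- same_roots (q x) (L x) v) ('X - a%:P))),
       P.[w x] = 0 /\ P^`().[w x] != 0,
    forall x y, deep (q x) (L x) y -> w x + deep_coef (q x) (L x) y != 0
    & forall x y, x != y -> same (q x) (L x) y -> w x != w y].
Proof.
move=> v0 cE gen.
pose g x := real_part2 (c x *: \prod_(a <- same_roots (q x) (L x) v) ('X - a%:P)).
(* The list of roots is chosen as a function of the data (q, L) rather than of the index, so that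
   branches with equal data draw from one list. *)
have rsE (k : {poly R} * nat) : exists rs : seq R[i], forall x, (q x, L x) = k ->
    [/\ uniq rs, size rs = #|same (q x) (L x)| & forall a, a \in rs ->
      [/\ (a^*)%C = a, (g x).[a] = 0 & (g x)^`().[a] != 0]].
  have [[x xk]|nx] := pselect (exists x, (q x, L x) = k); last first.
    by exists [::] => x xk; case: nx; exists x.
  have [c0 _] := gen x.
  have [rs [_ rsu rss rsP]] := hermite_biehler (fun a => @same_roots_Im (q x) (L x) v a v0) c0.
  exists rs => y yk; have := cE x y; rewrite xk yk => /(_ erefl) cxy.
  have [qE lE] : q y = q x /\ L y = L x by move: yk; rewrite -xk => -[-> ->].
  split => //; first by rewrite rss size_map -cardE qE lE.
  by move=> a /rsP; rewrite /g qE lE -cxy.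
have [rs rsP] := choice rsE.
(* Each branch takes the root of its own rank among the branches with the same data; the counts
   agree, so the default 0 is never reached. *)
pose w x := nth 0 (rs (q x, L x)) (index x (enum (same (q x) (L x)))).
have xin x : x \in enum (same (q x) (L x)) by rewrite mem_enum inE /=.
have wlt x : (index x (enum (same (q x) (L x))) < size (rs (q x, L x)))%N.
  by have [_ -> _] := rsP _ x erefl; rewrite cardE index_mem.
have win x : w x \in rs (q x, L x) by exact: mem_nth.
have wP x : [/\ ((w x)^*)%C = w x, (g x).[w x] = 0 & (g x)^`().[w x] != 0].
  by have [_ _] := rsP _ x erefl; apply.
have wdeep x y : deep (q x) (L x) y -> w x + deep_coef (q x) (L x) y != 0.
  move=> xy; have [_ gx _] := wP x; rewrite addr_eq0; apply/eqP => wE.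
  by have [_ /(_ y xy)] := gen x; rewrite -wE -/(g x) gx eqxx.
exists w; split => //.
- by move=> x; have [] := wP x.
- move=> x P; have [_ gx gx'] := wP x; rewrite /P -/(g x) derivM hornerD !hornerM gx.
  rewrite !mulr0 add0r; split => //; rewrite mulf_neq0//.
  rewrite /deep_prod horner_prod; apply/prodf_neq0 => y xy.
  by rewrite hornerD hornerX hornerC wdeep.
move=> x y xy /= /eqP[qE lE]; rewrite /w qE lE.
have [rsu _ _] := rsP _ x erefl.
rewrite nth_uniq//; last by have := wlt y; rewrite qE lE.
apply: contra xy => /eqP/(congr1 (nth x (enum (same (q x) (L x))))).
by rewrite !nth_index// -?qE -?lE//; move=> ->.
Qed.

End Splitting.

(** * Factorization of the pencil *)

Lemma near0_left (R : realType) (P : R[i] -> Prop) :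
  (\forall z \near (0 : R[i]^o), P z) ->
  \forall z1 \near (0 : R[i]^o) & z2 \near (0 : R[i]^o), P z1.
Proof.
by move=> nP; exists (P, setT) => /=; [split=> //; exact: filterT|move=> z []].
Qed.

Lemma real_analytic1N (R : realType) (g : R[i] -> R[i]) :
  real_analytic1 g -> real_analytic1 (fun z => - g z).
Proof.
case=> a ag; exists (fun n => - a n); apply: filterS ag => z gz.
rewrite (_ : series _ = - series (fun n => (a n)%:C%C * z ^+ n)).
  exact: (@cvgN _ R[i]^o _ _ _ _ _ gz).
apply/funext => N; rewrite /series /= fctE /= -sumrN; apply: eq_bigr => i _.
by rewrite rmorphN mulNr.
Qed.

Section PencilSplitting.
Variables (R : realType) (I : finType) (q : I -> {poly R}) (L : I -> nat).
Variables (p : {poly {poly R[i]}}) (u : R[i] -> R[i] -> R[i]).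
Variables (V : I -> R[i] -> R[i]^o) (v0 : I -> R[i]^o).
Hypothesis L_gt0 : forall x, (0 < L x)%N.
Hypothesis q0 : forall x, (q x).[0] = 0.
Hypothesis size_q : forall x, (size (q x) <= 2 * L x)%N.
Hypothesis u_unit : unit2 u.
Hypothesis V_v0 : forall x, V x @ (0 : R[i]^o)^' --> v0 x.
Hypothesis Im_v0 : forall x, 0 < complex.Im (v0 x).
Hypothesis pE : \near0 z1 z2, p.[z1, z2] =
  u z1 z2 * \prod_x Defs.factor (complex_poly (q x)) (L x) (V x z1) z1 z2.

Let node_limit (t : R) x : {poly R[i]} := real_part2 (pencil_coef t *:
  (u 0 0 *: \prod_y initial (q x) (L x) (q y) (L y) (v0 y))).

Let order x : nat := (\sum_y contact (q x) (L x) (q y) (L y))%N.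

Lemma cvg_pencil_node t x w :
  (fun z : R[i]^o => (pencil p t).[z, node (q x) (L x) w z] / z ^+ order x : R[i]^o)
     @ (0 : R[i]^o)^' --> ((node_limit t x).[w] : R[i]^o).
Proof.
apply: cvg_pencil => {}w; apply: (cvg_node_product (L_gt0 x) (q0 x) u_unit.1 pE) => y.
exact: (cvg_factor_node (@cvg_cst_dnbhs0 R w) (@V_v0 y)).
Qed.

Lemma factor_at0 x v z2 : Defs.factor (complex_poly (q x)) (L x) v 0 z2 = z2.
Proof.
rewrite /Defs.factor -[X in _.[X]](rmorph0 (real_complex R)) horner_map q0 rmorph0.
by rewrite addr0 expr0n muln_eq0 /= eqn0Ngt L_gt0 mul0r addr0.
Qed.

Lemma node_at0 x w : node (q x) (L x) w 0 = 0.
Proof. by rewrite -[LHS](factor_at0 x (- w)) /Defs.factor /node; ring. Qed.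

(** At z1 = 0 every factor reduces to z2, so p(0, z2) = u(0, z2) z2^#|I|. This coefficient will be
    the value at the origin of the cofactor of the roots. *)
Lemma coef_pencil0 t : ((pencil p t)`_0)`_#|I| =
  pencil_coef t * u 0 0 + (pencil_coef t * u 0 0)^*%C.
Proof.
have pl : (fun z : R[i]^o => (p`_0).[z] / z ^+ #|I| : R[i]^o) @ (0 : R[i]^o)^' -->
    (u 0 0 : R[i]^o).
  have c0 := @cvg_cst_dnbhs0 R 0.
  have := @analytic2_cvg _ _ _ _ (dnbhs_filter _) _ _ u_unit.1 c0 (@cvg_id_dnbhs R).
  apply: cvg_trans; apply: near_eq_cvg.
  have := @near0_comp _ _ _ _ (dnbhs_filter _) _ _ pE c0 (@cvg_id_dnbhs R).
  apply: filterS2 (dnbhs_neq0 R) => z z0 /=.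
  rewrite polyC0 horner_coef0 => ->; under eq_bigr do rewrite factor_at0.
  by rewrite prodr_const mulfK// expf_neq0.
have [_ p0] := coef_cvg_div pl.
rewrite /pencil; move: (pencil_coef t) => c.
by rewrite coefD !coefZ /conj_poly coef_map mul_polyC coefD coefZ mul_polyC coefZ
  coef_map p0 rmorphM.
Qed.

Lemma germ_node x (g : R[i] -> R[i]) : germ g -> germ (fun z => node (q x) (L x) (g z) z).
Proof.
move=> gg; apply: germD; first by apply: germN; exact: germ_poly.
apply: germM gg; under eq_fun do rewrite -hornerXn; exact: germ_poly.
Qed.

Lemma pencil_polygerm t : polygerm (size (swapXY (pencil p t))) (fun z => (pencil p t).[z%:P]).
Proof.
split=> [z|j]; first by rewrite horner_polyC; exact: size_poly.
by under eq_fun do rewrite horner_polyC coef_map; exact: germ_poly.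
Qed.

(** The difference of two nodes is a factor with v = - g y, taken along the node of x. Divided by
    its contact power it tends to an initial form at g x 0, nonzero in each case: deeper, same data,
    or neither. *)
Lemma node_neq x y (g : I -> R[i] -> R[i]) : (forall x, germ (g x)) ->
  (forall x y, deep q L (q x) (L x) y -> g x 0 + deep_coef q (q x) (L x) y != 0) ->
  (forall x y, x != y -> same q L (q x) (L x) y -> g x 0 != g y 0) ->
  x != y -> \forall z \near (0 : R[i]^o)^',
    node (q x) (L x) (g x z) z != node (q y) (L y) (g y z) z.
Proof.
move=> gg gdeep gneq.
(* The sign of Im (- g y 0) is unknown, so [initial_lt_neq0] is applied through its alternative 2 l
   <= 2 l'. *)
wlog lxy : x y / (L x <= L y)%N => [hw xy|xy].
  have [|/ltnW] := leqP (L x) (L y); first by move/hw; exact.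
  by move=> /hw; rewrite eq_sym => /(_ xy); apply: filterS => z; rewrite eq_sym.
have gc z := @germ_cvg _ _ _ _ (dnbhs_filter _) _ (gg z) (@cvg_id_dnbhs R).
have := cvg_factor_node (Q := q x) (l := L x) (Q' := q y) (l' := L y) (gc x)
  (@cvgN _ R[i]^o _ _ (dnbhs_filter _) _ _ (gc y)).
have l0 : (initial (q x) (L x) (q y) (L y) (- g y 0)).[g x 0] != 0.
  have [dxy|nd] := boolP (deep q L (q x) (L x) y).
    by rewrite initial_deeper// hornerD hornerX hornerC; exact: gdeep.
  have [sxy|ns] := boolP (same q L (q x) (L x) y).
    have /eqP[-> ->] := sxy; rewrite initial_same hornerD hornerX hornerC subr_eq0.
    exact: gneq.
  have clt := contact_not_deep size_q nd ns.
  by rewrite initial_lt// hornerC initial_lt_neq0//; left; rewrite leq_pmul2l.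
move=> lim; have := @cvgr_neq0 _ R[i]^o _ _ (dnbhs_filter _) _ _ lim l0.
apply: filterS => z; apply: contra => /eqP zE.
by rewrite fctE /Defs.factor zE /node mulf_eq0 /= (_ : _ + _ = 0) ?eqxx//; ring.
Qed.

Lemma pencil_splits : for_almost_all (fun t => exists psi : I -> R[i] -> R[i],
  (forall x, real_analytic1 (psi x)) /\
  exists2 U, unit2 U & \near0 z1 z2, (pencil p t).[z1, z2] =
    U z1 z2 * \prod_x Defs.factor (complex_poly (q x)) (L x) (psi x z1) z1 z2).
Proof.
have := for_almost_all_and (generic_pencil_coef size_q u_unit.2 Im_v0)
  (finite_pencil_coef u_unit.2).
apply: for_almost_all_sub => t [gen gen0].
pose c x := pencil_coef t * (u 0 0 * scalar_prod q L (q x) (L x) v0).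
have cE x y : (q x, L x) = (q y, L y) -> c x = c y by rewrite /c => -[-> ->].
have [w [wJ wroot wdeep wneq]] := exists_node_roots Im_v0 cE gen.
have gE x : exists g, [/\ germ g, real_analytic1 g, g 0 = w x &
    \forall z \near (0 : R[i]^o), (pencil p t).[z, node (q x) (L x) (g z) z] = 0].
  have [G [Greal GE G0 G1]] := node_polynomial (conj_pencil p t) (@cvg_pencil_node t x).
  have [] := wroot x; rewrite -/(c x) -(real_part2_initial size_q) => P0 P1.
  have Gw0 : G.[w x, 0] = 0 by rewrite G0.
  have Gw1 : G^`().[w x, 0] != 0 by rewrite G1.
  have [A [r [g [Areal Ag g0 gP]]]] := implicit_function_germ Greal (wJ x) Gw0 Gw1.
  exists g; split; [by exists A, r|exact: germ_real_analytic1 Ag|exact: g0|].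
  by apply: filterS gP => z gz; rewrite GE gz mulr0.
have [g gP] := choice gE.
have gg x : germ (g x) by have [] := gP x.
(* The root - q + z1^(2 L) g corresponds to the factor z2 + q - z1^(2 L) g. *)
exists (fun x z => - g x z); split.
  by move=> x; apply: real_analytic1N; have [] := gP x.
have [|||W Wg FW] := polygerm_div (pencil_polygerm t) (enum_uniq I)
    (y := fun x z => node (q x) (L x) (g x z) z).
- by move=> x _; exact: germ_node.
- by move=> x _; have [] := gP x.
- move=> x y _ _; apply: node_neq => // {}x {}y.
    by have [_ _ -> _] := gP x; exact: wdeep.
  by have [_ _ -> _] := gP x; have [_ _ -> _] := gP y; exact: wneq.
(* At z1 = 0 the linear factors multiply to z2^#|I|, so the cofactor at the origin is the
   coefficient of [coef_pencil0], nonzero by [gen0]. *)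
exists (fun z1 z2 => (W z1).[z2]).
  split; first exact: polygerm_analytic2 Wg.
  have := nbhs_singleton FW; rewrite polyC0 horner_coef0.
  have -> : \prod_(x <- enum I) ('X - (node (q x) (L x) (g x 0) 0)%:P) = 'X^#|I|.
    rewrite big_enum /= -prodr_const; apply: eq_bigr => x _.
    by rewrite node_at0 subr0.
  move=> /(congr1 (fun P : {poly _} => P`_#|I|)).
  by rewrite coef_pencil0 coefMXn ltnn subnn horner_coef0 => <-.
apply: filterS (near0_left FW) => -[z1 z2] /= ->.
rewrite hornerM horner_prod big_enum /=; congr (_ * _); apply: eq_bigr => x _.
by rewrite hornerXsubC /Defs.factor /node; ring.
Qed.

(** The limit of the pencil along the nodes of x, divided by one power of z1, is computed both from
    p and from the supposed factorization. The refined factor contributes w + a with a independent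
    of t, and the factor [deep_prod], present on both sides, cancels. *)
Lemma pencil_not_replaceable x (l' : nat) (q' : {poly R[i]})
    (psi : R -> I -> R[i] -> R[i]) (psi' : R -> R[i] -> R[i]) :
  (2 * L x < 2 * l')%N -> 'X^(2 * L x) %| q' - complex_poly (q x) ->
  ~ for_almost_all (fun t => (forall y, analytic1 (psi t y)) /\ analytic1 (psi' t) /\
    exists2 U, unit2 U & \near0 z1 z2, (pencil p t).[z1, z2] =
      U z1 z2 * \prod_y (if y == x then Defs.factor q' l' (psi' t z1) z1 z2
        else Defs.factor (complex_poly (q y)) (L y) (psi t y z1) z1 z2)).
Proof.
move=> ll' dvd fa.
pose d := q' - complex_poly (q x); pose a := d`_(2 * L x).
have dlow i : (i < 2 * L x)%N -> d`_i = 0.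
  by move=> il; have /dvdpP[k] := dvd; rewrite -/d => ->; rewrite coefMXn il.
pose k := u 0 0 * scalar_prod q L (q x) (L x) v0.
have k0 : k != 0 by rewrite mulf_neq0 ?u_unit.2// (scalar_prod_neq0 size_q).
pose h := \prod_(b <- same_roots q L (q x) (L x) v0) ('X - b%:P).
have root_a t : (forall y, analytic1 (psi t y)) /\ analytic1 (psi' t) /\
    (exists2 U, unit2 U & \near0 z1 z2, (pencil p t).[z1, z2] =
      U z1 z2 * \prod_y (if y == x then Defs.factor q' l' (psi' t z1) z1 z2
        else Defs.factor (complex_poly (q y)) (L y) (psi t y z1) z1 z2)) ->
    (real_part2 ((pencil_coef t * k) *: h)).[- a] = 0.
  move=> [psi_an [psi'_an [U Uu UE]]].
  pose li y := if y == x then 'X + a%:P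
    else initial (q x) (L x) (q y) (L y) (psi t y 0).
  have lim w : (fun z : R[i]^o => (pencil p t).[z, node (q x) (L x) w z] / z ^+ order x)
      @ (0 : R[i]^o)^' --> ((U 0 0 *: \prod_y li y).[w] : R[i]^o).
    apply: (cvg_node_product (L_gt0 x) (q0 x) Uu.1 UE) => y; rewrite /li.
    have [->|yx] := eqVneq y x; last first.
      apply: (cvg_factor_node (@cvg_cst_dnbhs0 R w)).
      exact: (@analytic1_cvg _ _ _ _ (dnbhs_filter _) _ (psi_an y) (@cvg_id_dnbhs R)).
    rewrite contact_same.
    have lim := cvg_factor_div (leqnn (2 * L x)) (ltnW ll') dlow (@cvg_cst_dnbhs0 R w)
      (@analytic1_cvg _ _ _ _ (dnbhs_filter _) _ psi'_an (@cvg_id_dnbhs R)).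
    rewrite eqxx (gtn_eqF ll') mul1r mul0r addr0 in lim.
    rewrite hornerD hornerX hornerC; apply: cvg_trans lim.
    apply: near_eq_cvg; apply: nearW => z /=; congr (_ / _).
    by rewrite /Defs.factor /node /d hornerD hornerN; ring.
  have limE : node_limit t x = U 0 0 *: \prod_y li y.
    apply: poly_ext => w.
    exact: (cvg_unique (@norm_hausdorff _ R[i]^o) (@cvg_pencil_node t x w) (lim w)).
  have nx : ~~ deep q L (q x) (L x) x by rewrite /deep /= /deeper ltnn.
  have liE : \prod_y li y = deep_prod q L (q x) (L x) *
      (('X + a%:P) * \prod_(y | (y != x) && ~~ deep q L (q x) (L x) y) li y).
    rewrite (bigD1 x) //= (bigID (deep q L (q x) (L x))) /= mulrCA; congr (_ * (_ * _)).
      apply: eq_big => y; first by apply: andb_idl => dy; apply: contraTneq dy => ->.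
      by move=> /andP[/negbTE yx dy]; rewrite /li yx initial_deeper.
    by rewrite /li eqxx.
  move: limE; rewrite /node_limit (real_part2_initial size_q) -/k -/h liE scalerAr.
  move=> /(mulfI (deep_prod_neq0 _ _ _ _)) ->.
  by rewrite hornerZ hornerM hornerD hornerX hornerC addNr mul0r mulr0.
have [s [t [st /root_a hs /root_a ht]]] := for_almost_all_two fa.
have [||ha hb] := pencil_coef_inj (x := k * h.[- a])
    (y := ((k * h.[((- a)^*)%C])^*)%C) st.
- by move: hs; rewrite horner_real_part2 !hornerZ -!mulrA rmorphM.
- by move: ht; rewrite horner_real_part2 !hornerZ -!mulrA rmorphM.
(* Both - a and its conjugate are zeros of h, so both would have negative imaginary part. *)
have Im_root b : k * h.[b] = 0 -> complex.Im b < 0.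
  move=> /eqP; rewrite mulf_eq0 (negbTE k0) /= -[_ == _]/(root h b) root_prod_XsubC.
  exact: same_roots_Im.
have /Im_root a1 := ha.
have /Im_root a2 : k * h.[((- a)^*)%C] = 0 by apply/eqP; rewrite -conjc_eq0 hb.
by move: a1 a2; case: (- a) => b c /= c0; rewrite oppr_lt0 ltNge ltW.
Qed.

End PencilSplitting.

(** * Reindexing of the Puiseux branches and conclusion *)

Lemma cvg_rootC0 (R : realType) n : (0 < n)%N ->
  (fun z : R[i]^o => n.-root z : R[i]^o) @ (0 : R[i]^o)^' --> (0 : R[i]^o).
Proof.
move=> n0; apply/cvgr0Pnorm_le => e e0.
apply: filterS (dnbhs0_le (exprn_gt0 n e0)) => z ze.
by rewrite -(ler_pXn2r n0) ?nnegrE ?(ltW e0)// -normrX rootCK.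
Qed.

Lemma prod_tagged (R : realType) (k : nat) (M : 'I_k -> nat)
    (F : forall j, 'I_(M j) -> R[i]) :
  \prod_(j < k) \prod_(m < M j) F j m =
  \prod_(x : {j : 'I_k & 'I_(M j)}) F (tag x) (tagged x).
Proof. exact: (sig_big_dep xpredT (fun _ => xpredT) F). Qed.

Lemma eq_tagged_val (k : nat) (M : 'I_k -> nat) j (m : 'I_(M j))
    (x : {j : 'I_k & 'I_(M j)}) :
  (x == Tagged (fun j => 'I_(M j)) m) = (tag x == j) && (tagged x == m :> nat).
Proof.
case: x => j' m' /=; have [jj|/negbTE jj] := eqVneq j' j; last first.
  by apply: contraFF jj => /eqP/(congr1 tag) /= ->.
by move: m'; rewrite jj => m' /=; rewrite -tag_eqE /tag_eq /= eqxx tagged_asE.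
Qed.

Theorem theorem2p20 (R : realType) (p : {poly {poly R[i]}}) (M : nat)
    (k : nat) (q : 'I_k -> {poly R}) (L Mj : 'I_k -> nat)
    (psi : 'I_k -> R[i] -> R[i]) (u : R[i] -> R[i] -> R[i]) :
  pure_stable p ->
  (1 <= M)%N -> vanishing_order p M ->
  puiseux_factorization p q L Mj psi u ->
  (exists psit : forall j, 'I_(Mj j) -> R -> R[i] -> R[i],
     family_factorization p q L psit) /\
  (forall psit : forall j, 'I_(Mj j) -> R -> R[i] -> R[i],
     family_factorization p q L psit ->
     ~ exists (j : 'I_k) (m : 'I_(Mj j)) (L' : nat) (q' : {poly R[i]})
              (psi' : R -> R[i] -> R[i]),
         [/\ (2 * L j < 2 * L')%N,
             (size q' <= 2 * L')%N,
             'X^(2 * L j) %| q' - complex_poly (q j)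
           & replaceable p q L psit m L' q' psi']).
Proof.
move=> _ _ _ pf.
pose I := {j : 'I_k & 'I_(Mj j)}.
(* The branch for a chosen root of z1; the shift by one matches [branch_prod], whose index starts at
   1 while ordinals start at 0. *)
pose V (x : I) z : R[i]^o :=
  psi (tag x) (Defs.root1 R (Mj (tag x)) ^+ (tagged x).+1 * (Mj (tag x)).-root z).
have LI (x : I) := pf_L pf (tag x).
have qI (x : I) := pf_q0 pf (tag x).
have sI (x : I) := pf_degq pf (tag x).
have vI (x : I) := pf_psi0 pf (tag x).
have VI (x : I) : V x @ (0 : R[i]^o)^' --> (psi (tag x) 0 : R[i]^o).
  apply: (@analytic1_cvg _ _ _ _ (dnbhs_filter _) _ (pf_psi pf (tag x))).
  rewrite -[X in _ --> X](mulr0 (Defs.root1 R (Mj (tag x)) ^+ (tagged x).+1)).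
  apply: (@cvgMl_tmp _ _ _ (dnbhs_filter _)).
  by apply: cvg_rootC0; exact: pf_M pf _.
have pE : \near0 z1 z2, p.[z1, z2] = u z1 z2 * \prod_(x : I)
    Defs.factor (complex_poly (q (tag x))) (L (tag x)) (V x z1) z1 z2.
  apply: filterS (pf_eq pf) => -[z1 z2] /=.
  move=> /(_ (fun j => (Mj j).-root z1)) ->; last first.
    by move=> j; rewrite rootCK// (pf_M pf).
  congr (_ * _).
  rewrite -(prod_tagged (fun j (m : 'I_(Mj j)) => Defs.factor (complex_poly (q j)) (L j)
    (psi j (Defs.root1 R (Mj j) ^+ m.+1 * (Mj j).-root z1)) z1 z2)).
  by apply: eq_bigr => j _; rewrite /branch_prod big_add1 /= big_mkord.
split.
  pose good t (psit : I -> R[i] -> R[i]) := (forall x, real_analytic1 (psit x)) /\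
    exists2 U, unit2 U & \near0 z1 z2, (pencil p t).[z1, z2] = U z1 z2 *
      \prod_x Defs.factor (complex_poly (q (tag x))) (L (tag x)) (psit x z1) z1 z2.
  (* Exceptional t impose no condition, so choice yields a family defined for all t. *)
  have goodE t : exists psit, (exists psit', good t psit') -> good t psit.
    have [[psit' g]|] := pselect (exists psit', good t psit'); first by exists psit'.
    by exists (fun _ _ => 0).
  have [psit psitP] := choice goodE.
  exists (fun j m t => psit t (Tagged (fun j => 'I_(Mj j)) m)).
  have := pencil_splits LI qI sI (pf_u pf) VI vI pE.
  apply: for_almost_all_sub => t /psitP[psit_real [U Uu UE]].
  split; first by move=> j m; exact: psit_real.
  exists U => //; apply: filterS UE => -[z1 z2] /=; rewrite horner_pencil => ->.
  by rewrite prod_tagged; congr (_ * _); apply: eq_bigr => -[].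
move=> psit fam [j [m [L' [q' [psi' [ll' _ dvd rep]]]]]].
pose x0 : I := Tagged (fun j => 'I_(Mj j)) m.
apply: (pencil_not_replaceable LI qI sI (pf_u pf) VI vI pE (x := x0)
  (psi := fun t x => psit (tag x) (tagged x) t) (psi' := psi') ll' dvd).
apply: for_almost_all_sub (for_almost_all_and fam rep).
move=> t [[psit_real _] [psi'_an [U Uu UE]]]; split.
  by move=> x; apply: real_analytic1_analytic1; exact: psit_real.
split => //; exists U => //; apply: filterS UE => -[z1 z2] /=.
rewrite horner_pencil => ->; rewrite prod_tagged; congr (_ * _).
by apply: eq_bigr => x _; rewrite eq_tagged_val; case: ifP.
Qed.
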